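(* Let $\mathbb{A}$ be any set of allowable test processes. Consider a computable forecasting system $\varphi\colon\mathbb{S}\to\mathcal{I}$ and a path $\omega\in\Omega$ that is $\mathbb{A}$-random for $\varphi$. Let $(I_1,\dots,I_n,\dots)$ be the corresponding sequence of interval forecasts $I_n=\varphi(\omega_{1:n-1})$ for the path $\omega$. If $S\colon\mathbb{S}\to\{0,1\}$ is a recursive selection process such that $\lim_{n\to\infty}\sum_{k=0}^{n}S(\omega_{1:k})=\infty$, then $$\liminf_{n\to\infty}\frac{\sum_{k=0}^{n-1}S(\omega_{1:k})\left[h(\omega_{k+1})-\underline{E}_{I_{k+1}}(h)\right]}{\sum_{k=0}^{n-1}S(\omega_{1:k})}\ge 0\quad\text{for any gamble }h\text{ on }\{0,1\}.$$
   Context: Notation: $\mathbb{N}=\{1,2,\dots\}$, $\mathbb{N}_0=\mathbb{N}\cup\{0\}$. Situations are the finite binary sequences $\mathbb{S}=\bigcup_{n\in\mathbb{N}_0}\{0,1\}^n$, with $\square$ the empty sequence; $sx$ is $s$ with $x\in\{0,1\}$ appended. Paths are elements $\omega$ of $\Omega=\{0,1\}^{\mathbb{N}}$, with $n$-th entry $\omega_n$; $\omega_{1:n}\in\mathbb{S}$ consists of the first $n$ entries, $\omega_{1:0}=\square$. $\mathcal{I}$ is the set of non-empty closed subintervals of $[0,1]$. A gamble on $\{0,1\}$ is a map $f\colon\{0,1\}\to\mathbb{R}$. With $E_p(f)=pf(1)+(1-p)f(0)$, put $\underline{E}_I(f)=\min_{p\in I}E_p(f)$ and $\overline{E}_I(f)=\max_{p\in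 I}E_p(f)$ for $I\in\mathcal{I}$. A forecasting system is a map $\varphi\colon\mathbb{S}\to\mathcal{I}$, with $\underline{\varphi}(s)=\min\varphi(s)$ and $\overline{\varphi}(s)=\max\varphi(s)$. A selection process is a map $S\colon\mathbb{S}\to\{0,1\}$. A real process is a map $F\colon\mathbb{S}\to\mathbb{R}$, with $\Delta F(s)(x)=F(sx)-F(s)$. A test process is a non-negative real process with $F(\square)=1$. A supermartingale for $\varphi$ is a real process $M$ with $\overline{E}_{\varphi(s)}(\Delta M(s))\le 0$ for all $s\in\mathbb{S}$; a test supermartingale for $\varphi$ is a test process that is a supermartingale for $\varphi$. Computability: ''recursive'' means computable by a Turing machine (countable sets such as $\mathbb{S}$ and $\mathbb{S}\times\mathbb{N}_0$ are identified with $\mathbb{N}_0$ by recursive bijections with recursive inverse). A real process $F$ is computable if there are a recursive family of rationals $r_{s,n}$ and a recursive map $e\colon\mathbb{S}\times\mathbb{N}_0\to\mathbb{N}_0$ such that $n\ge e(s,N)$ implies $|r_{s,n}-F(s)|\le 2^{-N}$. A forecasting system $\varphi$ is computable if $\underline{\varphi}$ and $\overline{\varphi}$ are. A set of allowable test processes is any countable set $\mathbb{A}$ of test processes that contains all computable (strictly) positive test processes. A path $\omega$ is $\mathbb{A}$-random for $\varphi$ if $\sup_{n\in\mathbb{N}}T(\omega_{1:n})<\infty$ for every $T\in\mathbb{A}$ that is a test supermartingale for $\varphi$. *)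

(* Defs.v *)
From HB Require Import structures.
From Stdlib Require Cantor.
From mathcomp Require Import all_boot all_order all_algebra.
From mathcomp Require Import all_classical all_reals all_analysis.
Import Order.TTheory GRing.Theory Num.Theory.
Import numFieldNormedType.Exports.

Set Implicit Arguments.
Unset Strict Implicit.
Unset Printing Implicit Defensive.

Local Open Scope classical_set_scope.

(** * Turing machines *)

(* [lft] lists the cells to the left of the head, nearest first, and [rgt] the
   cells to its right; all cells beyond the two lists are blank. *)
Record tape (G : Type) := Tape { lft : seq G; cur : G; rgt : seq G }.

Inductive move := MoveL | Stay | MoveR.

Definition tape_act (G : Type) (blank : G) (t : tape G) (a : G * move) :
    tape G :=
  match a.2 with
  | MoveL => Tape (behead (lft t)) (head blank (lft t)) (a.1 :: rgt t)
  | Stay => Tape (lft t) a.1 (rgt t)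
  | MoveR => Tape (a.1 :: lft t) (head blank (rgt t)) (behead (rgt t))
  end.

(* A deterministic machine with [(ntapes M).+1] two-way infinite tapes; it
   halts when no transition applies. *)
Record turing_machine := TuringMachine {
  ntapes : nat;
  symbol : finType;
  state : finType;
  blank : symbol;
  mark : symbol;
  mark_neq_blank : mark != blank;
  start : state;
  delta : state -> {ffun 'I_ntapes.+1 -> symbol} ->
          option (state * ('I_ntapes.+1 -> symbol * move))
}.

Definition config (M : turing_machine) : Type :=
  state M * ('I_(ntapes M).+1 -> tape (symbol M)).

Definition step (M : turing_machine) (c : config M) : option (config M) :=
  if delta c.1 [ffun i => cur (c.2 i)] is Some (q, act)
  then Some (q, fun i => tape_act (blank M) (c.2 i) (act i))
  else None.

(* Numbers are written in unary on tape 0, immediately to the right of the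
   head. *)
Definition init_config (M : turing_machine) (n : nat) : config M :=
  (start M, fun i =>
     Tape [::] (blank M) (if i == ord0 then nseq n (mark M) else [::])).

Definition output (M : turing_machine) (c : config M) : nat :=
  find (predC1 (mark M)) (rgt (c.2 ord0)).

Definition run (M : turing_machine) (n t : nat) : config M :=
  iter t (fun c => odflt c (step c)) (init_config M n).

Definition computes (M : turing_machine) (f : nat -> nat) : Prop :=
  forall n, exists t, step (run M n t) = None /\ output (run M n t) = f n.

Definition recursive (f : nat -> nat) : Prop :=
  exists M : turing_machine, computes M f.

(** * Situations and paths *)

Definition situation := seq bool.

(* The entry of index [n >= 1] of a path is the value at [n.-1]. *)
Definition binpath := nat -> bool.

Definition initseg (omega : binpath) (n : nat) : situation := mkseq omega n.

(* Bijective base-2 numeration: 0 and 1 are read as the digits 1 and 2. *)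
Definition sit_code (s : situation) : nat :=
  foldl (fun n (x : bool) => n.*2 + x.+1)%N 0%N s.

Lemma sit_code_rcons (s : situation) (x : bool) :
  sit_code (rcons s x) = ((sit_code s).*2 + x.+1)%N.
Proof. by rewrite /sit_code foldl_rcons. Qed.

Lemma sit_code_bij : bijective sit_code.
Proof.
have inj : injective sit_code.
  elim/last_ind => [|s x IH]; elim/last_ind => [|u y _] //.
  - by rewrite sit_code_rcons addnS.
  - by rewrite sit_code_rcons addnS.
  rewrite !sit_code_rcons !addnS => -[] e.
  have exy : x = y.
    by have := congr1 odd e; rewrite !oddD !odd_double; case: x y {e} => -[].
  move: e; rewrite exy => /addIn /double_inj e.
  by rewrite (IH _ e).
have surj n : exists s, sit_code s == n.
  elim/ltn_ind: n => -[_|n IH]; first by exists [::].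
  have [|s /eqP e] := IH n./2; first by rewrite ltnS -divn2 leq_div.
  exists (rcons s (odd n)).
  by rewrite sit_code_rcons e addnS addnC odd_double_half.
exists (fun n => xchoose (surj n)) => [s|n].
  by apply: inj; apply/eqP; apply: xchooseP (surj (sit_code s)).
by apply/eqP; apply: xchooseP (surj n).
Qed.

Definition recursive_sit (f : situation -> nat) : Prop :=
  exists2 g, recursive g & forall s, g (sit_code s) = f s.

Definition recursive_sit_nat (f : situation -> nat -> nat) : Prop :=
  exists2 g, recursive g &
    forall s n, g (Cantor.to_nat (sit_code s, n)) = f s n.

Definition selection_process := situation -> bool.

Definition recursive_selection (S : selection_process) : Prop :=
  recursive_sit (fun s => nat_of_bool (S s)).

Local Open Scope ring_scope.

(* A recursive family of rationals is given by recursive signs, numerators and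
   nonzero denominators. *)
Definition recursive_rat (r : situation -> nat -> rat) : Prop :=
  exists sg num den : situation -> nat -> nat,
    [/\ recursive_sit_nat sg, recursive_sit_nat num, recursive_sit_nat den,
        forall s n, den s n != 0%N &
        forall s n, r s n = (-1) ^+ sg s n * (num s n)%:R / (den s n)%:R].

Section Forecasting.
Context {R : realType}.

Definition real_process := situation -> R.

Definition computable (F : real_process) : Prop :=
  exists (r : situation -> nat -> rat) (e : situation -> nat -> nat),
    [/\ recursive_rat r, recursive_sit_nat e &
        forall s N n, (e s N <= n)%N -> `|ratr (r s n) - F s| <= 2 ^- N].

Definition gamble := bool -> R.

Definition expectation (p : R) (f : gamble) : R :=
  p * f true + (1 - p) * f false.

Record subinterval := Subinterval {
  lo : R;
  hi : R;
  lo_ge0 : 0 <= lo;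
  lo_le_hi : lo <= hi;
  hi_le1 : hi <= 1
}.

Definition in_subinterval (I : subinterval) : set R :=
  [set p | lo I <= p <= hi I].

(* The infimum and supremum are attained, as [I] is compact and [expectation]
   is continuous in [p]. *)
Definition lower_expectation (I : subinterval) (f : gamble) : R :=
  inf [set expectation p f | p in in_subinterval I].

Definition upper_expectation (I : subinterval) (f : gamble) : R :=
  sup [set expectation p f | p in in_subinterval I].

Definition forecasting_system := situation -> subinterval.

Definition computable_forecasting (phi : forecasting_system) : Prop :=
  computable (fun s => lo (phi s)) /\ computable (fun s => hi (phi s)).

(* Meaningful for [n >= 1]. *)
Definition interval_forecast (phi : forecasting_system) (omega : binpath)
    (n : nat) : subinterval :=
  phi (initseg omega n.-1).

Definition process_diff (F : real_process) (s : situation) : gamble :=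
  fun x => F (rcons s x) - F s.

Definition test_process (F : real_process) : Prop :=
  (forall s, 0 <= F s) /\ F [::] = 1.

Definition positive_process (F : real_process) : Prop := forall s, 0 < F s.

Definition supermartingale (phi : forecasting_system) (M : real_process) :
    Prop :=
  forall s, upper_expectation (phi s) (process_diff M s) <= 0.

Definition test_supermartingale (phi : forecasting_system) (M : real_process) :
    Prop :=
  test_process M /\ supermartingale phi M.

Definition allowable (A : set real_process) : Prop :=
  [/\ countable A,
      A `<=` test_process &
      forall F, test_process F -> positive_process F -> computable F -> A F].

Definition random_for (A : set real_process) (phi : forecasting_system)
    (omega : binpath) : Prop :=
  forall T, A T -> test_supermartingale phi T ->
    (ereal_sup [set (T (initseg omega n))%:E | n in [set n | (1 <= n)%N]]
       < +oo)%E.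

End Forecasting.

Arguments real_process : clear implicits.
Arguments gamble : clear implicits.
Arguments subinterval : clear implicits.
Arguments forecasting_system : clear implicits.

(* Main.v *)
(* If lo' is a rational lower approximation of the lower forecast, then, for
   rational xi, the process T(s) = prod_u (1 - xi S(u) (x_u - lo'(u))), the
   product running over the situations u before s with x_u the outcome that
   follows u, is a positive test supermartingale. Rounding lo' to a multiple of
   a fixed 2^-m makes T exactly rational, hence computable. Along a random path
   T is bounded, and 1 - z >= exp(-z - 2 z^2) turns this bound into a lower bound
   of the selected averages of x - lo by a quantity of order -xi as the number
   of selections grows. Upper forecasts are treated alike, and every gamble h is
   an affine function of the outcome, so one of the two cases applies to it.

   That T is computed by a Turing machine is shown by compiling expressions with
   primitive recursion and calls to given machines into loop programs on
   registers, and these into machines that hold one unary register per tape;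
   each call runs on the same scratch tapes, which it erases afterwards. *)

Require Import Defs.
From HB Require Import structures.
From Stdlib Require Cantor.
From mathcomp Require Import all_boot all_order all_algebra.
From mathcomp Require Import all_classical all_reals all_analysis.
From mathcomp Require Import zify lra ring.
Import Order.TTheory GRing.Theory Num.Theory.
Import numFieldNormedType.Exports.

Set Implicit Arguments.
Unset Strict Implicit.
Unset Printing Implicit Defensive.

(** * Combinators for multitape machines *)

Section Machines.
Variables (N K : nat).
Notation G := (option 'I_K.+1).
Notation tapes := ('I_N.+1 -> tape G).
Notation action := ('I_N.+1 -> G * move).
Implicit Types t : tapes.

(** Unlike in [turing_machine], the number of tapes and the alphabet are parameters, so that several
    machines can act in turn on the same tapes. *)
Record mach := Mach {
  mstate : finType;
  mstart : mstate;
  mdelta : mstate -> {ffun 'I_N.+1 -> G} -> option (mstate * action)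
}.

Definition mstep (m : mach) (c : mstate m * tapes) :
    option (mstate m * tapes) :=
  if mdelta c.1 [ffun i => cur (c.2 i)] is Some (q, act)
  then Some (q, fun i => tape_act None (c.2 i) (act i))
  else None.

Inductive reach (m : mach) (c : mstate m * tapes) : mstate m * tapes -> Prop :=
| reach0 : reach c c
| reachS c' c'' : mstep c = Some c' -> reach c' c'' -> reach c c''.

Lemma reach_trans (m : mach) (c c' c'' : mstate m * tapes) :
  reach c c' -> reach c' c'' -> reach c c''.
Proof. by elim=> // {c'}c d e ce _ IH /IH; apply: reachS ce. Qed.

Definition evalm (m : mach) t t' :=
  exists q, reach (mstart m, t) (q, t') /\ mstep (q, t') = None.

(** A machine halts when no transition applies, so handing control over to another machine costs one
    step of its own; this is the action of that step, and [noopE] says that it changes no tape. *)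
Definition noop (v : {ffun 'I_N.+1 -> G}) : action := fun i => (v i, Stay).

Lemma noopE t : (fun i => tape_act None (t i) (noop [ffun i => cur (t i)] i)) = t.
Proof. by apply/funext => i; rewrite /tape_act /noop ffunE /=; case: (t i). Qed.

Definition upd t (j : 'I_N.+1) (x : tape G) : tapes := fun i => if i == j then x else t i.

Lemma updE t j x : upd t j x j = x.
Proof. by rewrite /upd eqxx. Qed.

Lemma updNE t j x i : i != j -> upd t j x i = t i.
Proof. by rewrite /upd => /negbTE ->. Qed.

Definition mhalt : mach := @Mach unit tt (fun _ _ => None).

Lemma evalm_halt t : evalm mhalt t t.
Proof. by exists tt; split => //; apply: reach0. Qed.

Definition mact (j : 'I_N.+1) (f : G -> G) (mv : move) : mach :=
  @Mach bool false (fun q v =>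
    if q then None
    else Some (true, fun i => if i == j then (f (v i), mv) else (v i, Stay))).

Lemma evalm_act j f mv t :
  evalm (mact j f mv) t (upd t j (tape_act None (t j) (f (cur (t j)), mv))).
Proof.
exists true; split=> //; apply: (@reachS (mact j f mv) _ (true, _)); last exact: reach0.
rewrite /mstep /=; congr (Some (_, _)); apply/funext => i; rewrite /upd ffunE.
by case: eqP => [->//|_]; rewrite /tape_act /=; case: (t i).
Qed.

Definition mseq (m1 m2 : mach) : mach :=
  @Mach (mstate m1 + mstate m2)%type (inl (mstart m1)) (fun q v =>
    match q with
    | inl q => if mdelta q v is Some (q', a) then Some (inl q', a)
               else Some (inr (mstart m2), noop v)
    | inr q => if mdelta q v is Some (q', a) then Some (inr q', a) else None
    end).

(** A map of states that preserves single steps carries over whole runs; it serves for the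
    components of [mseq] and for the body of [mwhile]. *)
Lemma reach_map (m m' : mach) (g : mstate m -> mstate m') :
  (forall q t q' t', @mstep m (q, t) = Some (q', t') ->
     @mstep m' (g q, t) = Some (g q', t')) ->
  forall q t q' t', @reach m (q, t) (q', t') -> @reach m' (g q, t) (g q', t').
Proof.
move=> H q t q' t'.
suff L c d : @reach m c d -> @reach m' (g c.1, c.2) (g d.1, d.2) by move/L.
elim=> [{}c|{}c c' c'' e _ IH]; first exact: reach0.
by apply: reachS IH; case: c c' e => [? ?] [? ?] /= /H.
Qed.

Lemma evalm_seq (m1 m2 : mach) t t' t'' :
  evalm m1 t t' -> evalm m2 t' t'' -> evalm (mseq m1 m2) t t''.
Proof.
move=> [q [r1 h1]] [q' [r2 h2]]; exists (inr q'); split; last first.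
  by move: h2; rewrite /mstep /=; case: mdelta => [[]|].
apply: (@reach_trans (mseq m1 m2) _ (inl q, t')).
  apply: (@reach_map m1 (mseq m1 m2) inl) r1 => u s u' s'.
  by rewrite /mstep /=; case: mdelta => [[? ?]|] // [<- <-].
apply: (@reachS (mseq m1 m2) _ (inr (mstart m2), t')).
  by move: h1; rewrite /mstep /=; case: mdelta => [[]|] // _; rewrite noopE.
apply: (@reach_map m2 (mseq m1 m2) inr) r2 => u s u' s'.
by rewrite /mstep /=; case: mdelta => [[? ?]|] // [<- <-].
Qed.

(** State [None] is the test of the loop; a halt of the body leads back to it. *)
Definition mwhile (j : 'I_N.+1) (P : pred G) (m : mach) : mach :=
  @Mach (option (mstate m)) None (fun q v =>
    match q with
    | None => if P (v j) then Some (Some (mstart m), noop v) else None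
    | Some q => if mdelta q v is Some (q', a) then Some (Some q', a)
                else Some (None, noop v)
    end).

Lemma evalm_while_stop j (P : pred G) m t : ~~ P (cur (t j)) -> evalm (mwhile j P m) t t.
Proof.
move=> h; exists None; split; first exact: reach0.
by rewrite /mstep /= ffunE (negbTE h).
Qed.

Lemma evalm_while_step j (P : pred G) m t t' t'' : P (cur (t j)) -> evalm m t t' ->
  evalm (mwhile j P m) t' t'' -> evalm (mwhile j P m) t t''.
Proof.
move=> h [q [r1 h1]] [q' [r2 h2]]; exists q'; split=> //.
apply: (@reachS (mwhile j P m) _ (Some (mstart m), t)).
  by rewrite /mstep /= ffunE h noopE.
apply: (@reach_trans (mwhile j P m) _ (Some q, t')).
  apply: (@reach_map m (mwhile j P m) Some) r1 => u s u' s'.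
  by rewrite /mstep /=; case: mdelta => [[? ?]|] // [<- <-].
apply: reachS r2; move: h1; rewrite /mstep /=.
by case: mdelta => [[]|] // _; rewrite noopE.
Qed.

(* [None] is the blank of the combined machine. Simulated machines never write
   it, so the cells that they visit form a contiguous block of entries [Some _],
   and a tape can be erased by a sweep to both ends of that block. *)
Definition blanks (l : seq G) := all (pred1 None) l.

Fixpoint packed (l : seq G) : bool :=
  match l with
  | [::] => true
  | None :: l => blanks l
  | Some _ :: l => packed l
  end.

Lemma blanks_packed l : blanks l -> packed l.
Proof. by case: l => [|[]]. Qed.

Lemma packed_behead l : packed l -> packed (behead l).
Proof. by case: l => [|[x|] l] //= /blanks_packed. Qed.

Lemma blanks_head l : blanks l -> head None l = None.
Proof. by case: l => [|[]]. Qed.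

Lemma blanks_behead l : blanks l -> blanks (behead l).
Proof. by case: l => [|x l] //= /andP[]. Qed.

Definition contig (x : tape G) := packed (lft x) && packed (rgt x).

Lemma contig_act (x : tape G) k mv :
  contig x -> contig (tape_act None x (Some k, mv)).
Proof.
by case: mv => /andP[hl hr]; rewrite /contig /= ?hl ?hr ?packed_behead.
Qed.

(** The layout is that of [init_config]: head on a blank, numeral on its right. Explicit blanks are
    allowed in both lists, because a head that moves over a blank cell stores it there. For [n = 0]
    the symbol [g] is immaterial, so an erased tape is a register with value 0. *)
Definition isreg (g : G) (n : nat) (x : tape G) :=
  [/\ cur x = None, blanks (lft x) &
      exists2 l, rgt x = nseq n g ++ l & blanks l].

Lemma isreg_contig k n x : isreg (Some k) n x -> contig x.
Proof.
case=> _ hl [l e hr]; rewrite /contig blanks_packed //= e.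
by elim: n {e} => //=; apply: blanks_packed.
Qed.

(** The head cell becomes the first cell of the numeral and the blank on its left becomes the new
    head cell, so an increment is one step. *)
Lemma isreg_inc g n x : isreg g n x -> isreg g n.+1 (tape_act None x (g, MoveL)).
Proof.
case=> h0 hl [l e hr]; split => /=; [exact: blanks_head|exact: blanks_behead|].
by exists l; rewrite // e.
Qed.

(** Marking the head cell first joins the blocks on its two sides. The sweep to the left then ends
    just beyond the joined block, and the sweep to the right erases all of it. *)
Definition mclean j : mach :=
  mseq (mact j (fun=> Some ord0) Stay)
  (mseq (mwhile j (fun x => x != None) (mact j (fun=> Some ord0) MoveL))
  (mseq (mact j (fun=> None) MoveR)
        (mwhile j (fun x => x != None) (mact j (fun=> None) MoveR)))).

Lemma upd_upd t j x y : upd (upd t j x) j y = upd t j y.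
Proof. by apply/funext => i; rewrite /upd; case: eqP. Qed.

Lemma upd_id t j : upd t j (t j) = t.
Proof. by apply/funext => i; rewrite /upd; case: eqP => [->|]. Qed.

Lemma mclean_left j t : cur (t j) != None -> contig (t j) ->
  exists2 x, [/\ cur x = None, blanks (lft x) & packed (rgt x)] &
    evalm (mwhile j (fun x => x != None) (mact j (fun=> Some ord0) MoveL))
      t (upd t j x).
Proof.
move=> h /andP[hl hr].
have [l el] : exists l, l = lft (t j) by eexists.
elim: l t el h hl hr => [|g l IH] t el h hl hr.
  exists (tape_act None (t j) (Some ord0, MoveL)); rewrite /= -?el //.
  apply: evalm_while_step h (evalm_act _ _ _ _) _.
  by apply: evalm_while_stop; rewrite updE /= -el.
case: g => [a|] in el; last first.
  exists (tape_act None (t j) (Some ord0, MoveL)).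
    by split; rewrite /= -?el //=; move: hl; rewrite -el.
  apply: evalm_while_step h (evalm_act _ _ _ _) _.
  by apply: evalm_while_stop; rewrite updE /= -el.
have := IH (upd t j (tape_act None (t j) (Some ord0, MoveL))).
rewrite updE /= -el => /(_ erefl isT); case; [by move: hl; rewrite -el|by []|].
move=> x hx; rewrite upd_upd => ev; exists x => //.
exact: evalm_while_step h (evalm_act _ _ _ _) ev.
Qed.

Lemma mclean_right j t : packed (cur (t j) :: rgt (t j)) -> blanks (lft (t j)) ->
  exists2 x, isreg None 0 x &
    evalm (mwhile j (fun x => x != None) (mact j (fun=> None) MoveR))
      t (upd t j x).
Proof.
have [l el] : exists l, l = rgt (t j) by eexists.
elim: l t el => [|g l IH] t el; case ec : (cur (t j)) => [c|].
- move=> _ hl; exists (tape_act None (t j) (None, MoveR)).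
    by split => //=; rewrite -?el //; exists [::].
  apply: evalm_while_step (evalm_act _ _ _ _) _; first by rewrite ec.
  by apply: evalm_while_stop; rewrite updE /= -el.
- move=> _ hl; exists (t j); first by split=> //; exists [::]; rewrite -?el.
  by rewrite upd_id; apply: evalm_while_stop; rewrite ec.
- move=> hp hl; have := IH (upd t j (tape_act None (t j) (None, MoveR))).
  rewrite updE /= -el /= => /(_ erefl); rewrite -el in hp; case => // x hx.
  rewrite upd_upd => ev; exists x => //.
  by apply: evalm_while_step (evalm_act _ _ _ _) ev; rewrite ec.
- move=> hp hl; exists (t j); first by split=> //; exists (rgt (t j)).
  by rewrite upd_id; apply: evalm_while_stop; rewrite ec.
Qed.

Lemma evalm_clean j t : contig (t j) ->
  exists2 x, isreg None 0 x & evalm (mclean j) t (upd t j x).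
Proof.
move=> ht.
have [||x [x1 x2 x3]] := @mclean_left j
    (upd t j (tape_act None (t j) (Some ord0, Stay))).
- by rewrite updE.
- by rewrite updE; apply: contig_act.
rewrite upd_upd => ev1.
have [||y hy] := @mclean_right j (upd t j (tape_act None x (None, MoveR))).
- by rewrite updE /=; case: (rgt x) x3.
- by rewrite updE.
rewrite upd_upd => ev2; exists y => //.
apply: evalm_seq (evalm_act _ _ _ _) (evalm_seq ev1 (evalm_seq _ ev2)).
by have := evalm_act j (fun=> None) MoveR (upd t j x); rewrite updE upd_upd.
Qed.

Definition mcleans (s : seq 'I_N.+1) := foldr (fun j => mseq (mclean j)) mhalt s.

Lemma evalm_cleans s t : (forall j, j \in s -> contig (t j)) ->
  exists t', [/\ evalm (mcleans s) t t',
    forall j, j \in s -> isreg None 0 (t' j) &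
    forall j, j \notin s -> t' j = t j].
Proof.
elim: s t => [|j s IH] t ht.
  by exists t; split => //; apply: evalm_halt.
have [x hx ev] := evalm_clean (ht j (mem_head _ _)).
have hx' : contig x by case: hx => _ h1 [l e h2]; rewrite /contig e !blanks_packed.
have [|t' [ev' t'1 t'2]] := IH (upd t j x).
  move=> i si; rewrite /upd; case: eqP => // _.
  by apply: ht; rewrite inE si orbT.
exists t'; split.
- exact: evalm_seq ev ev'.
- move=> i; rewrite inE; case: (boolP (i \in s)) => [/t'1 //|/t'2 ->].
  by rewrite orbF => /eqP ->; rewrite updE.
- by move=> i; rewrite inE negb_or => /andP[ij /t'2 ->]; rewrite updNE.
Qed.

Definition mk : G := Some ord0.

(** The head steps onto the first mark and blanks it. That cell is then the head cell of a register
    whose value is one less, and in this position the body runs. *)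
Definition mloop j (m : mach) : mach :=
  mseq (mact j (fun=> None) MoveR)
    (mwhile j (pred1 mk)
      (mseq (mact j (fun=> None) Stay) (mseq m (mact j (fun=> None) MoveR)))).

(** [P k] is the invariant with [k] rounds to go. By the second premise it does not depend on which
    tape represents [k]: each round shifts the numeral and leaves one more explicit blank on its
    left. *)
Lemma evalm_loop j m (P : nat -> tapes -> Prop) :
  (forall k t, P k t -> isreg mk k (t j)) ->
  (forall k t x, P k t -> isreg mk k x -> P k (upd t j x)) ->
  (forall k t x, P k.+1 t -> isreg mk k x ->
     exists2 t', evalm m (upd t j x) t' & P k t') ->
  forall k t, P k t -> exists2 t', evalm (mloop j m) t t' & P 0%N t'.
Proof.
move=> H1 H2 H3.
suff W k t : P k t -> exists2 t', evalm (mwhile j (pred1 mk)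
      (mseq (mact j (fun=> None) Stay) (mseq m (mact j (fun=> None) MoveR))))
      (upd t j (tape_act None (t j) (None, MoveR))) t' & P 0%N t'.
  move=> k t /W [t' ev Pt']; exists t' => //.
  exact: evalm_seq (evalm_act _ _ _ _) ev.
elim: k t => [|k IH] t Pt; have [c0 hl [l e hr]] := H1 _ _ Pt.
  exists (upd t j (tape_act None (t j) (None, MoveR))).
    by apply: evalm_while_stop; rewrite updE /= e blanks_head.
  apply: H2 => //; split => /=; rewrite ?e ?blanks_head //.
  by exists (behead l); rewrite ?blanks_behead.
have [|t1 ev1 Pt1] := H3 k t (Tape (None :: lft (t j)) None (nseq k mk ++ l)) Pt.
  by split => //; exists l.
have [t2 ev2 Pt2] := IH _ Pt1; exists t2 => //.
apply: evalm_while_step ev2; first by rewrite updE /= e.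
apply: evalm_seq (evalm_act _ _ _ _) (evalm_seq _ (evalm_act _ _ _ _)).
by rewrite upd_upd updE /tape_act /= e.
Qed.

(** * Running a given Turing machine on a block of tapes *)

Section Lift.
Variables (M : turing_machine) (r : nat).
Hypothesis cardM : (#|symbol M| <= K.+1)%N.
Hypothesis tapesM : (r + (ntapes M).+1 <= N.+1)%N.

(** The blank of [M] is encoded as some [Some _] too, which keeps lifted machines from writing
    [None]; [dec] reads both as the blank of [M]. *)
Definition enc (a : symbol M) : G := Some (inord (index a (enum (symbol M)))).
Definition dec (g : G) : symbol M :=
  if g is Some k then nth (blank M) (enum (symbol M)) k else blank M.

Arguments enc : simpl never.
Arguments dec : simpl never.

Lemma encK : cancel enc dec.
Proof.
move=> a; rewrite /dec /enc inordK ?nth_index ?mem_enum //.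
by apply: leq_trans cardM; rewrite cardE index_mem mem_enum.
Qed.

Definition emb (j : 'I_(ntapes M).+1) : 'I_N.+1 := inord (r + j).

Lemma embE j : emb j = r + j :> nat.
Proof.
by rewrite inordK //; apply: leq_trans tapesM; rewrite ltn_add2l.
Qed.

Lemma emb_inj : injective emb.
Proof.
by move=> i j /(congr1 val) /=; rewrite !embE => /addnI /val_inj.
Qed.

Definition mlift : mach :=
  @Mach (state M) (start M) (fun q v =>
    if delta q [ffun j => dec (v (emb j))] is Some (q', a)
    then Some (q', fun i =>
      if [pick j | emb j == i] is Some j then (enc (a j).1, (a j).2)
      else (v i, Stay))
    else None).

(** Cells are compared one by one with default values, since a blank may be explicit on one tape and
    lie beyond the list on the other. *)
Definition tsim (x : tape (symbol M)) (y : tape G) :=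
  [/\ dec (cur y) = cur x,
      forall k, dec (nth None (lft y) k) = nth (blank M) (lft x) k &
      forall k, dec (nth None (rgt y) k) = nth (blank M) (rgt x) k].

Lemma tsim_act x y a : tsim x y ->
  tsim (tape_act (blank M) x a) (tape_act None y (enc a.1, a.2)).
Proof.
case: a => a mv [h0 hl hr]; case: mv; split => //=; rewrite -?nth0 ?encK //.
- by move=> k; rewrite !nth_behead.
- by case=> [|k] //=; rewrite encK.
- by case=> [|k] //=; rewrite encK.
- by move=> k; rewrite !nth_behead.
Qed.

Lemma mlift_step (c : config M) t :
  (forall j, tsim (c.2 j) (t (emb j))) ->
  match step c with
  | None => @mstep mlift (c.1, t) = None
  | Some c' => exists t', [/\ @mstep mlift (c.1, t) = Some (c'.1, t'),
      forall j, tsim (c'.2 j) (t' (emb j)),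
      forall i, i \notin codom emb -> t' i = t i &
      forall i, contig (t i) -> contig (t' i)]
  end.
Proof.
case: c => q u /= hs; rewrite /step /mstep /=.
have -> : [ffun j => dec ([ffun i => cur (t i)] (emb j))] = [ffun i => cur (u i)].
  by apply/ffunP => j; rewrite !ffunE; case: (hs j).
case: delta => [[q' a]|] //=.
eexists; split; first reflexivity.
- move=> j /=; case: (pickP (fun i => emb i == emb j)) => [i /eqP|/(_ j)];
    last by rewrite eqxx.
  move=> /emb_inj ->.
  exact: tsim_act.
- move=> i /codomP ni; case: (pickP (fun j => emb j == i)) => [j /eqP e|_].
    by case: ni; exists j.
  by rewrite ffunE /tape_act; case: (t i).
- move=> i ci /=; case: (pickP (fun j => emb j == i)) => [j _|_];
    first exact: contig_act.
  by rewrite ffunE /tape_act; case: (t i) ci.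
Qed.

Lemma mlift_run k (c : config M) t :
  (forall j, tsim (c.2 j) (t (emb j))) ->
  let c' := iter k (fun c => odflt c (step c)) c in
  exists t', [/\ @reach mlift (c.1, t) (c'.1, t'),
      forall j, tsim (c'.2 j) (t' (emb j)),
      forall i, i \notin codom emb -> t' i = t i &
      forall i, contig (t i) -> contig (t' i)].
Proof.
elim: k c t => [|k IH] c t hs.
  by exists t; split => //; apply: reach0.
rewrite iterSr; have := mlift_step hs; case: step => [c1|_] /=; last exact: IH.
move=> [t1 [e1 s1 u1 g1]]; have [t2 [e2 s2 u2 g2]] := IH _ _ s1.
exists t2; split => //; first exact: (@reachS mlift _ _ _ e1 e2).
- by move=> i ni; rewrite u2 // u1.
- by move=> i /g1 /g2.
Qed.

Lemma evalm_lift n f t : computes M f ->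
  (forall j, isreg (enc (mark M)) (if j == ord0 then n else 0%N) (t (emb j))) ->
  exists t', [/\ evalm mlift t t',
      find (predC1 (mark M)) (map dec (rgt (t' (emb ord0)))) = f n,
      forall i, i \notin codom emb -> t' i = t i &
      forall j, contig (t' (emb j))].
Proof.
move=> /(_ n) [k [halt out]] ht.
have hs : forall j, tsim ((init_config M n).2 j) (t (emb j)).
  move=> j; have [h0 hl [l e hr]] := ht j.
  have nb l' k' : blanks l' -> nth None l' k' = None.
    move=> /allP b; case: (ltnP k' (size l')) => [|/(nth_default None) //].
    by move=> /(mem_nth None) /b /eqP.
  split => /=; rewrite ?h0 //.
    by move=> k'; rewrite nb // nth_nil.
  move=> k'; rewrite e nth_cat size_nseq.
  case: ltnP => kn.
    by rewrite nth_nseq kn encK; case: eqP kn => // _ kn; rewrite nth_nseq kn.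
  by rewrite nb //=; case: eqP kn => [_ kn|_ _]; rewrite nth_default // size_nseq.
have [t' [r' s' u' g']] := mlift_run k hs; exists t'; split => //.
- exists (run M n k).1; split; first exact: r'.
  by have := mlift_step s'; rewrite halt.
- rewrite -out /output; have [_ _] := s' ord0.
  move: (rgt _) (rgt _) => l' l.
  (* Where one list ends, the other reads as blank, which differs from [mark M]; hence both counts
     stop there. *)
  elim: l l' => [|x l IH] [|x' l'] h //=.
  + by have := h 0%N; rewrite /= => <-; rewrite eq_sym mark_neq_blank.
  + by have := h 0%N; rewrite /= => ->; rewrite eq_sym mark_neq_blank.
  have := h 0%N; rewrite /= => ->; case: eqP => //= _.
  by congr _.+1; apply: IH => i; apply: (h i.+1).
- by move=> j; apply: g'; apply: isreg_contig (ht j).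
Qed.
End Lift.
End Machines.

(** * Register programs *)

Section Programs.
Variables (I : finType) (M : I -> turing_machine) (f : I -> nat -> nat).
Hypothesis Mf : forall o, computes (M o) (f o).

Inductive prog :=
| Skip
| Inc of nat
| Seq of prog & prog
| Loop of nat & prog
| Call of I & nat.

Definition setr (s : nat -> nat) i v : nat -> nat :=
  fun j => if j == i then v else s j.

(** Register [i] is decremented before each round and the body must return it unchanged, so the
    number of rounds is fixed on entry. *)
Inductive loop_rel (i : nat) (E : (nat -> nat) -> (nat -> nat) -> Prop) :
    (nat -> nat) -> (nat -> nat) -> Prop :=
| loop_stop s : s i = 0 -> loop_rel i E s s
| loop_step s s' s'' k : s i = k.+1 -> E (setr s i k) s' -> s' i = k ->
    loop_rel i E s' s'' -> loop_rel i E s s''.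

Lemma loop_relS i E s s' k : loop_rel i E s s' -> s i = k.+1 ->
  exists s1, [/\ E (setr s i k) s1, s1 i = k & loop_rel i E s1 s'].
Proof.
case=> [s0 ->//|s0 s1 s2 k' -> e z l [ek]]; rewrite ek in e z.
by exists s1.
Qed.

Lemma loop_rel0 i E s s' : loop_rel i E s s' -> s i = 0 -> s' = s.
Proof. by case=> // s0 s1 s2 k' ->. Qed.

Fixpoint exec (p : prog) : (nat -> nat) -> (nat -> nat) -> Prop :=
  match p with
  | Skip => eq
  | Inc i => fun s s' => s' = setr s i (s i).+1
  | Seq p q => fun s s' => exists2 s1, exec p s s1 & exec q s1 s'
  | Loop i p => loop_rel i (exec p)
  | Call o i => fun s s' => s' = setr s i (f o (s i))
  end.

Fixpoint bounded (r : nat) (p : prog) : bool :=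
  match p with
  | Skip => true
  | Inc i => i < r
  | Seq p q => bounded r p && bounded r q
  | Loop i p => (i < r) && bounded r p
  | Call _ i => i < r
  end.

Lemma bounded_leq r r' p : r <= r' -> bounded r p -> bounded r' p.
Proof.
move=> le_r; elim: p => //= [i /leq_trans ->//|p IHp q IHq /andP[/IHp -> /IHq]//||].
  by move=> i p IH /andP[/leq_trans -> // /IH].
by move=> _ i /leq_trans ->.
Qed.

Lemma bounded_ex p : exists r, bounded r p.
Proof.
elim: p => [|i|p [r hr] q [r' hr']|i p [r hr]|o i].
- by exists 0.
- by exists i.+1 => /=.
- exists (maxn r r'); rewrite /=.
  by rewrite (bounded_leq (leq_maxl _ _) hr) (bounded_leq (leq_maxr _ _) hr').
- by exists (maxn r i.+1); rewrite /= leq_maxr (bounded_leq (leq_maxl _ _) hr).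
- by exists i.+1 => /=.
Qed.

(** * Compilation of register programs into machines *)

Section Compile.
Variables (N K r : nat).
Hypothesis cardM : forall o, #|symbol (M o)| <= K.+1.
Hypothesis tapesM : forall o, r + (ntapes (M o)).+1 <= N.+1.
Hypothesis r_le : r <= N.+1.
Notation G := (option 'I_K.+1).
Notation tapes := ('I_N.+1 -> tape G).
Notation reg := (fun i : nat => inord i : 'I_N.+1).
Notation mk := (mk K).

(** The tapes from [r] on are the scratch tapes of calls; they are empty between instructions. *)
Definition rep (s : nat -> nat) (t : tapes) :=
  (forall i, i < r -> isreg mk (s i) (t (reg i))) /\
  (forall i : 'I_N.+1, r <= i -> isreg mk 0 (t i)).

Lemma regE i : i < r -> reg i = i :> nat.
Proof. by move=> ir; rewrite inordK // (leq_trans ir). Qed.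

Lemma reg_inj i j : i < r -> j < r -> reg i = reg j -> i = j.
Proof. by move=> ir jr /(congr1 val) /=; rewrite !regE. Qed.

Lemma rep_set s t i v x : i < r -> rep s t -> isreg mk v x ->
  rep (setr s i v) (upd t (reg i) x).
Proof.
move=> ir [H1 H2] hx; split=> j jr.
  rewrite /setr /upd; case: eqP => [->|ne]; first by rewrite eqxx.
  by case: eqP => [/reg_inj e|_]; [case: ne; apply: e|apply: H1].
rewrite updNE; first exact: H2.
by apply: contraTneq jr => ->; rewrite -ltnNge regE.
Qed.

Section Call.
Variables (o : I) (i : nat).
Hypothesis ir : i < r.
Notation Mo := (M o).
Notation em := (enc K (mark Mo)).
Notation embo := (@emb N Mo r).
Notation sr := (embo ord0).
Notation dec := (@dec K Mo).

(** The argument moves to the first scratch tape, in marks of [M o], which empties register [i].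
    After the run, each mark to the right of the head increments register [i]. The cells read are
    overwritten with a non-blank symbol, so that the tape remains one block and can be erased. *)
Definition mcall : mach N K :=
  mseq (mloop (reg i) (mact sr (fun=> em) MoveL))
  (mseq (mlift N K Mo r)
  (mseq (mact sr (fun=> mk) MoveR)
  (mseq (mwhile sr (fun x => dec x == mark Mo)
           (mseq (mact (reg i) (fun=> mk) MoveL) (mact sr (fun=> mk) MoveR)))
        (mcleans K (codom embo))))).

Lemma reg_emb k j : k < r -> reg k != embo j.
Proof.
move=> kr; apply/eqP => /(congr1 val) /=; rewrite regE // embE // => e.
by move: kr; rewrite e ltnNge leq_addr.
Qed.

Lemma mcall_in n t : isreg mk n (t (reg i)) -> isreg em 0 (t sr) ->
  exists2 t', evalm (mloop (reg i) (mact sr (fun=> em) MoveL)) t t' &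
    [/\ isreg mk 0 (t' (reg i)), isreg em n (t' sr) &
        forall j, j != reg i -> j != sr -> t' j = t j].
Proof.
move=> h1 h2.
pose P k (t1 : tapes) := exists w, [/\ k + w = n, isreg mk k (t1 (reg i)),
    isreg em w (t1 sr) & forall j, j != reg i -> j != sr -> t1 j = t j].
have [||||t' ev [w [e p1 p2 p3]]] :=
    @evalm_loop _ _ (reg i) (mact sr (fun=> em) MoveL) P _ _ _ n t.
- by move=> k t1 [w []].
- move=> k t1 x [w [e p1 p2 p3]] hx; exists w; split => //.
  + by rewrite updE.
  + by rewrite updNE // eq_sym reg_emb.
  + by move=> j j1 j2; rewrite updNE // p3.
- move=> k t1 x [w [e p1 p2 p3]] hx; eexists; first exact: evalm_act.
  exists w.+1; split.
  + by rewrite addnS.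
  + by rewrite updNE ?reg_emb // updE.
  + by rewrite updE updNE 1?eq_sym ?reg_emb //; apply: isreg_inc.
  + by move=> j j1 j2; rewrite !updNE // p3.
- by exists 0; rewrite addn0.
by exists t' => //; split => //; rewrite -e.
Qed.

Lemma mcall_out l n t : cur (t sr) = head None l -> rgt (t sr) = behead l ->
  contig (t sr) -> isreg mk n (t (reg i)) ->
  exists2 t', evalm (mwhile sr (fun x => dec x == mark Mo)
      (mseq (mact (reg i) (fun=> mk) MoveL) (mact sr (fun=> mk) MoveR))) t t' &
    [/\ isreg mk (n + find (predC1 (mark Mo)) (map dec l)) (t' (reg i)),
        contig (t' sr) &
        forall j, j != reg i -> j != sr -> t' j = t j].
Proof.
elim: l n t => [|x l IH] n t e1 e2 hc hi.
  exists t; last by rewrite addn0.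
  by apply: evalm_while_stop; rewrite e1 /= eq_sym mark_neq_blank.
have [ex|nex] := eqVneq (dec x) (mark Mo); last first.
  exists t; last by rewrite /= nex addn0.
  by apply: evalm_while_stop; rewrite e1 /= nex.
pose t1 := upd t (reg i) (tape_act None (t (reg i)) (mk, MoveL)).
pose t2 := upd t1 sr (tape_act None (t1 sr) (mk, MoveR)).
have rs : reg i != sr by apply: reg_emb.
have t1s : t1 sr = t sr by rewrite /t1 updNE // eq_sym.
have [||||t' ev [h1 h2 h3]] := IH n.+1 t2.
- by rewrite /t2 updE t1s /= e2.
- by rewrite /t2 updE t1s /= e2.
- by rewrite /t2 updE t1s; apply: contig_act.
- by rewrite /t2 updNE // /t1 updE; apply: isreg_inc.
exists t'.
  apply: evalm_while_step ev; first by rewrite e1 /= ex.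
  exact: evalm_seq (evalm_act _ _ _ _) (evalm_act _ _ _ _).
split => //; first by rewrite /= ex eqxx /= addnS.
by move=> j j1 j2; rewrite h3 // /t2 updNE // /t1 updNE.
Qed.

Lemma evalm_call s t : rep s t ->
  exists2 t', evalm mcall t t' & rep (setr s i (f o (s i))) t'.
Proof.
move=> [H1 H2].
have Hc j : isreg em 0 (t (embo j)) by apply: H2; rewrite embE // leq_addr.
have rs : reg i != sr by apply: reg_emb.
have [t1 ev1 [i1 s1 o1]] := mcall_in (H1 i ir) (Hc ord0).
have [|t2 [ev2 f2 o2 c2]] :=
    @evalm_lift N K Mo r (cardM o) (tapesM o) (s i) (f o) t1 (Mf o).
  move=> j; case: eqP => [->//|/eqP nj]; rewrite o1 //; first by rewrite eq_sym reg_emb.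
  by apply: contra nj => /eqP /(emb_inj (tapesM o)) ->.
have nreg k : k < r -> reg k \notin codom embo.
  by move=> kr; apply/codomP => -[j]; apply/eqP/reg_emb.
pose t3 := upd t2 sr (tape_act None (t2 sr) (mk, MoveR)).
have [||||t4 ev4 [i4 c4 o4]] := @mcall_out (rgt (t2 sr)) 0 t3.
- by rewrite /t3 updE.
- by rewrite /t3 updE.
- by rewrite /t3 updE; apply: contig_act.
- by rewrite /t3 updNE // o2 ?nreg.
rewrite f2 add0n in i4.
have [|t5 [ev5 z5 o5]] := @evalm_cleans N K (codom embo) t4.
  move=> _ /codomP[j ->]; have [->//|nj] := eqVneq (embo j) sr.
  by rewrite o4 // 1?eq_sym ?reg_emb // /t3 updNE.
exists t5.
  apply: evalm_seq ev1 (evalm_seq ev2 (evalm_seq (evalm_act _ _ _ _) _)).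
  exact: evalm_seq ev4 ev5.
have off j : j \notin codom embo -> j != reg i -> t5 j = t j.
  move=> nj ji; have js : j != sr by apply: contraNneq nj => ->; rewrite codom_f.
  by rewrite o5 // o4 // /t3 updNE // o2 // o1.
split=> j jr.
  rewrite /setr; case: eqP => [->|ne]; first by rewrite o5 // nreg.
  rewrite off ?nreg //; first exact: H1.
  by apply/eqP => /reg_inj e; apply: ne; apply: e.
have [/z5 //|nj] := boolP (j \in codom embo).
rewrite off //; first exact: H2.
by apply: contraTneq jr => ->; rewrite -ltnNge regE.
Qed.
End Call.

Fixpoint compile (p : prog) : mach N K :=
  match p with
  | Skip => mhalt N K
  | Inc i => mact (reg i) (fun=> mk) MoveL
  | Seq p q => mseq (compile p) (compile q)
  | Loop i p => mloop (reg i) (compile p)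
  | Call o i => mcall o i
  end.

Lemma compileP p s s' t : bounded r p -> exec p s s' -> rep s t ->
  exists2 t', evalm (compile p) t t' & rep s' t'.
Proof.
elim: p s s' t => [|i|p IHp q IHq|i p IHp|o i] s s' t /=.
- by move=> _ <- h; exists t => //; apply: evalm_halt.
- move=> ir -> h; eexists; first exact: evalm_act.
  by apply: rep_set => //; apply: isreg_inc; apply: h.1.
- move=> /andP[bp bq] [s1 ep eq] h.
  have [t1 ev1 /(IHq _ _ _ bq eq) [t2 ev2 h2]] := IHp _ _ _ bp ep h.
  by exists t2 => //; apply: evalm_seq ev1 ev2.
- move=> /andP[ir bp] el h.
  (* The loop still to be run from the represented state, and not the rounds already done, is what
     the invariant records; it leads to [s'] throughout. *)
  pose P k t := exists s0, [/\ rep s0 t, s0 i = k & loop_rel i (exec p) s0 s'].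
  have [||||t' ev [s0 [h0 z0 l0]]] := @evalm_loop N K (reg i) (compile p) P _ _ _ (s i) t.
  + by move=> k t1 [s1 [[h1 _] <- _]]; apply: h1.
  + move=> k t1 x [s1 [h1 e1 l1]] hx; exists s1; split => //.
    have -> : s1 = setr s1 i k by apply/funext => j; rewrite /setr; case: eqP => [->|].
    exact: rep_set.
  + move=> k t1 x [s1 [h1 e1 l1]] hx.
    have [s2 [e2 z2 l2]] := loop_relS l1 e1.
    have [t' ev' h'] := IHp _ _ _ bp e2 (rep_set ir h1 hx).
    by exists t' => //; exists s2.
  + by exists s.
  exists t' => //; by rewrite (loop_rel0 l0 z0).
- by move=> ir -> h; apply: evalm_call.
Qed.
End Compile.

Lemma prog_recursive (p : prog) (g : nat -> nat) :
  (forall n, exists2 s', exec p (setr (fun=> 0) 0 n) s' & s' 0 = g n) ->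
  recursive g.
Proof.
move=> Hp.
have [r0 b0] := bounded_ex p.
(* The successor ensures that register 0, which holds input and output, exists. *)
pose r := r0.+1; have b : bounded r p by apply: bounded_leq b0.
(* As [I] is finite, one block of scratch tapes and one alphabet are large enough for all the
   machines [M o]. *)
pose W := \max_o (ntapes (M o)).+1; pose K := \max_o #|symbol (M o)|.
pose N := r0 + W.
have cardM o : #|symbol (M o)| <= K.+1 by apply/leqW/(leq_bigmax o).
have tapesM o : r + (ntapes (M o)).+1 <= N.+1.
  by rewrite /N -addSn leq_add2l (leq_bigmax o).
have r_le : r <= N.+1 by rewrite ltnS leq_addr.
pose m := compile N K r p.
have mk_blank : mk K != None by [].
exists (TuringMachine mk_blank (mstart m) (@mdelta _ _ m)) => n.
set T := TuringMachine _ _ _.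
have hrep : rep r (setr (fun=> 0) 0 n) (init_config T n).2.
  split => [i ir|i ir] /=; split => //=.
    exists [::] => //; rewrite cats0 /setr.
    have -> : (inord i == ord0 :> 'I_N.+1) = (i == 0).
      by rewrite -val_eqE /= inordK // (leq_trans ir).
    by case: (i == 0).
  by exists [::] => //; rewrite -val_eqE /=; case: (i : nat) ir.
have [s' es' <-] := Hp n.
have [t' [q [rq hq]] [h' _]] := compileP cardM tapesM r_le b es' hrep.
suff [k ek] : exists k, iter k (fun c => odflt c (@mstep _ _ m c))
    (mstart m, (init_config T n).2) = (q, t').
  exists k; have -> : run T n k = (q, t') by exact: ek.
  split => //; rewrite /output /=.
  have [_ _ [l]] := h' 0 isT.
  have -> : inord 0 = ord0 :> 'I_N.+1 by apply: val_inj; rewrite /= inordK.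
  move=> -> hl; elim: (s' 0) => [|k0 IH] /=; last by rewrite ?eqxx IH.
  by case: l hl => [|x l] //= /andP[/eqP -> _].
elim: rq => [c|c c' c'' e _ [k ek]]; first by exists 0.
by exists k.+1; rewrite iterSr e.
Qed.
End Programs.

(** * Primitive recursive expressions *)

Lemma setr_id s i : setr s i (s i) = s.
Proof. by apply/funext => j; rewrite /setr; case: eqP => [->|]. Qed.

Lemma setrE s i v : setr s i v i = v.
Proof. by rewrite /setr eqxx. Qed.

Lemma setrNE s i v j : j != i -> setr s i v j = s j.
Proof. by rewrite /setr => /negbTE ->. Qed.

Arguments exec : simpl never.

Section Terms.
Variables (I : finType) (f : I -> nat -> nat).

(* [Var i] is the entry of index [i] of the environment. The body of [Rec] sees
   two further entries: the loop counter, which runs downwards to 0, and the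
   accumulator. *)
Inductive tm :=
| Var of nat
| Zero
| Succ of tm
| Orc of I & tm
| Rec of tm & tm & tm
| App1 of tm & tm
| App2 of tm & tm & tm.

Fixpoint downto (n : nat) (g : nat -> nat -> nat) (a : nat) : nat :=
  if n is k.+1 then downto k g (g k a) else a.

Fixpoint denote (env : seq nat) (e : tm) : nat :=
  match e with
  | Var i => nth 0 env i
  | Zero => 0
  | Succ e => (denote env e).+1
  | Orc o e => f o (denote env e)
  | Rec en e0 es =>
      downto (denote env en) (fun k a => denote (env ++ [:: k; a]) es) (denote env e0)
  | App1 e a => denote [:: denote env a] e
  | App2 e a b => denote [:: denote env a; denote env b] e
  end.

Fixpoint wf (k : nat) (e : tm) : bool :=
  match e with
  | Var i => i < k
  | Zero => true
  | Succ e => wf k e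
  | Orc _ e => wf k e
  | Rec en e0 es => [&& wf k en, wf k e0 & wf k.+2 es]
  | App1 e a => wf 1 e && wf k a
  | App2 e a b => [&& wf 2 e, wf k a & wf k b]
  end.

Notation prog := (prog I).
Notation exec := (exec f).

(* [env] lists the registers that hold the environment; the result goes to
   register [d], and all registers from [d] on are free. *)
Fixpoint tcomp (env : seq nat) (d : nat) (e : tm) : prog :=
  match e with
  | Var i => let i := nth 0 env i in
      Seq (Loop i (Seq (Inc _ d) (Inc _ d.+1))) (Loop d.+1 (Inc _ i))
  | Zero => Skip _
  | Succ e => Seq (tcomp env d e) (Inc _ d)
  | Orc o e => Seq (tcomp env d e) (Call o d)
  | Rec en e0 es =>
      Seq (tcomp env d en) (Seq (tcomp env d.+1 e0)
      (Seq (Loop d (Seq (tcomp (env ++ [:: d; d.+1]) d.+2 es)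
                   (Seq (Loop d.+1 (Skip _)) (Loop d.+2 (Inc _ d.+1)))))
           (Loop d.+1 (Inc _ d))))
  | App1 e a =>
      Seq (tcomp env d a) (Seq (tcomp [:: d] d.+1 e)
      (Seq (Loop d (Skip _)) (Loop d.+1 (Inc _ d))))
  | App2 e a b =>
      Seq (tcomp env d a) (Seq (tcomp env d.+1 b)
      (Seq (tcomp [:: d; d.+1] d.+2 e)
      (Seq (Loop d (Skip _)) (Seq (Loop d.+1 (Skip _)) (Loop d.+2 (Inc _ d))))))
  end.

Lemma exec_seq p q s1 s s' :
  exec p s s1 -> exec q s1 s' -> exec (Seq p q) s s'.
Proof. by exists s1. Qed.

Lemma exec_stop i p s : s i = 0 -> exec (Loop i p) s s.
Proof. exact: loop_stop. Qed.

Lemma exec_step i p s s' s'' k : s i = k.+1 -> exec p (setr s i k) s' ->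
  s' i = k -> exec (Loop i p) s' s'' -> exec (Loop i p) s s''.
Proof. exact: loop_step. Qed.

Lemma exec_loop i p (P : nat -> nat -> nat) n :
  (forall k, P k i = k) ->
  (forall k, exec p (setr (P k.+1) i k) (P k)) ->
  exec (Loop i p) (P n) (P 0).
Proof.
move=> H1 H2; elim: n => [|k IH]; first exact: exec_stop.
by apply: exec_step IH; [apply: H1|apply: H2|apply: H1].
Qed.

Lemma exec_clear i s : exec (Loop i (Skip _)) s (setr s i 0).
Proof.
have := @exec_loop i (Skip _) (setr s i) (s i); rewrite setr_id; apply=> k.
  by rewrite setrE.
by apply/funext => j; rewrite /setr; case: eqP.
Qed.

Lemma exec_move i j s : i != j ->
  exec (Loop i (Inc _ j)) s (setr (setr s i 0) j (s j + s i)).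
Proof.
move=> ij.
pose P k := setr (setr s i k) j (s j + (s i - k)).
have -> : s j + s i = s j + (s i - 0) by rewrite subn0.
suff H n : n <= s i -> exec (Loop i (Inc _ j)) (P n) (P 0).
  by have := H _ (leqnn _); rewrite {1}/P subnn addn0 !setr_id.
elim: n => [_|k IH ki]; first by apply: exec_stop; rewrite /P setrNE // setrE.
apply: exec_step (IH (ltnW ki)) => /=;
  [by rewrite /P setrNE // setrE| |by rewrite /P setrNE // setrE].
apply/funext => l; rewrite /P /setr !eqxx; do ![case: eqP => ?] => //; lia.
Qed.

Lemma exec_copy i d s : i < d -> s d = 0 -> s d.+1 = 0 ->
  exec (Seq (Loop i (Seq (Inc _ d) (Inc _ d.+1))) (Loop d.+1 (Inc _ i))) s
    (setr s d (s i)).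
Proof.
move=> id s0 s1.
pose P k := setr (setr (setr s i k) d (s i - k)) d.+1 (s i - k).
have ne1 : i != d by lia.
have ne2 : i != d.+1 by lia.
have ne3 : d != d.+1 by lia.
apply: (exec_seq (s1 := P 0)).
  have e : s = P (s i).
    apply/funext => j; rewrite /P /setr subnn.
    by do ![case: eqP => [->//|_]].
  suff H n : n <= s i -> exec (Loop i (Seq (Inc _ d) (Inc _ d.+1))) (P n) (P 0).
    by rewrite {1}e; apply: H.
  elim: n => [_|k IH ki]; first by apply: exec_stop; rewrite /P setrNE // setrNE // setrE.
  have Pi k' : P k' i = k' by rewrite /P setrNE // setrNE // setrE.
  apply: exec_step (IH (ltnW ki)) => //; apply: exec_seq; first reflexivity.
  apply/funext => l; rewrite /P /setr !eqxx.
  do ![case: eqP => ?] => //; lia.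
have -> : setr s d (s i) = setr (setr (P 0) d.+1 0) i (P 0 i + P 0 d.+1).
  apply/funext => l; rewrite /P /setr.
  do ![case: eqP => ?] => //; subst; lia.
by apply: exec_move; rewrite eq_sym.
Qed.

Lemma exec_to p s s1 s' : exec p s s1 -> s1 = s' -> exec p s s'.
Proof. by move=> h <-. Qed.

Lemma map_setr (s : nat -> nat) d v (env : seq nat) : all (fun i => i < d) env ->
  map (setr s d v) env = map s env.
Proof.
move=> /allP h; apply/eq_in_map => i /h id; rewrite setrNE //; lia.
Qed.

Lemma all_ltnS d (env : seq nat) :
  all (fun i => i < d) env -> all (fun i => i < d.+1) env.
Proof. by apply: sub_all => i /ltnW. Qed.

(** The final state is given on all registers: only [d] has changed, and every temporary is back at
    0. This lets the results of subterms be stacked from [d] upwards in the induction. *)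
Lemma tcompP e env d s : wf (size env) e -> all (fun i => i < d) env ->
  (forall j, d <= j -> s j = 0) ->
  exec (tcomp env d e) s (setr s d (denote (map s env) e)).
Proof.
elim: e env d s =>
  [i||e IH|o e IH|en IHn e0 IH0 es IHs|e IH a IHa|e IH a IHa b IHb] env d s /=.
- move=> ie hd h0; have id : nth 0 env i < d by apply: (allP hd); apply: mem_nth.
  apply: exec_to; first by apply: exec_copy => //; apply: h0.
  by rewrite (nth_map 0).
- by move=> _ _ h0; rewrite -(h0 d (leqnn d)) setr_id.
- move=> w hd h0; apply: exec_seq; first exact: IH.
  by apply/funext => j; rewrite /setr eqxx; case: eqP.
- move=> w hd h0; apply: exec_seq; first exact: IH.
  by apply/funext => j; rewrite /setr eqxx; case: eqP.
- move=> /and3P[wn w0 ws] hd h0.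
  set n := denote _ en; set a0 := denote _ e0; set g := fun k a => _.
  pose P k a := setr (setr s d k) d.+1 a.
  apply: (exec_seq (s1 := setr s d n)); first exact: IHn.
  apply: (exec_seq (s1 := P n a0)).
    rewrite /P /a0 -(map_setr s n hd).
    apply: IH0 => //; first exact: all_ltnS.
    by move=> j jd; rewrite setrNE ?h0 //; lia.
  apply: (exec_seq (s1 := P 0 (downto n g a0))).
    move: n a0 => n; elim: n => [|k IH] a0.
      by apply: exec_stop; rewrite /P setrNE ?setrE //; lia.
    have Pd k' a : P k' a d = k' by rewrite /P setrNE ?setrE //; lia.
    apply: exec_step (IH (g k a0)) => //; rewrite {1}/P.
    have -> : setr (setr (setr s d k.+1) d.+1 a0) d k = P k a0.
      by apply/funext => j; rewrite /P /setr; do ![case: eqP => ?] => //; lia.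
    have em : map (P k a0) (env ++ [:: d; d.+1]) = map s env ++ [:: k; a0].
      rewrite map_cat /= /P !map_setr ?all_ltnS //.
      by rewrite setrE setrNE ?setrE //; lia.
    have := IHs (env ++ [:: d; d.+1]) d.+2 (P k a0); rewrite size_cat addn2.
    rewrite em -/(g k a0) => IHs'.
    apply: (exec_seq (s1 := setr (P k a0) d.+2 (g k a0))).
      apply: IHs' => //; first by rewrite all_cat /= !all_ltnS //= !ltnS leqnn leqnSn.
      by move=> j jd; rewrite /P setrNE ?setrNE ?h0 //; lia.
    apply: (exec_seq (s1 := setr (setr (P k a0) d.+2 (g k a0)) d.+1 0));
      first exact: exec_clear.
    apply: exec_to; first by apply: exec_move; lia.
    apply/funext => j; rewrite /P /setr; do ![case: eqP => ?] => //; subst; rewrite ?h0; lia.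
  apply: exec_to; first by apply: exec_move; lia.
  apply/funext => j; rewrite /P /setr; do ![case: eqP => ?] => //; subst; rewrite ?h0; lia.
- move=> /andP[we wa] hd h0; set va := denote _ a.
  apply: (exec_seq (s1 := setr s d va)); first exact: IHa.
  apply: (exec_seq (s1 := setr (setr s d va) d.+1 (denote [:: va] e))).
    have := IH [:: d] d.+1 (setr s d va); rewrite /= setrE; apply => //.
      by rewrite ltnS leqnn.
    by move=> j jd; rewrite setrNE ?h0 //; lia.
  apply: (exec_seq (s1 := setr (setr (setr s d va) d.+1 (denote [:: va] e)) d 0));
    first exact: exec_clear.
  apply: exec_to; first by apply: exec_move; lia.
  apply/funext => j; rewrite /setr; do ![case: eqP => ?] => //; subst; rewrite ?h0; lia.
- move=> /and3P[we wa wb] hd h0; set va := denote _ a; set vb := denote _ b.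
  apply: (exec_seq (s1 := setr s d va)); first exact: IHa.
  pose s1 := setr (setr s d va) d.+1 vb.
  apply: (exec_seq (s1 := s1)).
    rewrite /s1 /vb -(map_setr s va hd).
    apply: IHb => //; first exact: all_ltnS.
    by move=> j jd; rewrite setrNE ?h0 //; lia.
  apply: (exec_seq (s1 := setr s1 d.+2 (denote [:: va; vb] e))).
    have := IH [:: d; d.+1] d.+2 s1; rewrite /= /s1 setrE setrNE ?setrE; last lia.
    apply => //; first by rewrite !ltnS leqnn leqnSn.
    by move=> j jd; rewrite setrNE ?setrNE ?h0 //; lia.
  apply: exec_seq; first exact: exec_clear.
  apply: exec_seq; first exact: exec_clear.
  apply: exec_to; first by apply: exec_move; lia.
  apply/funext => j; rewrite /s1 /setr; do ![case: eqP => ?] => //; subst; rewrite ?h0; lia.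
Qed.

Lemma term_recursive e :
  (forall o, recursive (f o)) -> wf 1 e -> recursive (fun n => denote [:: n] e).
Proof.
move=> /choice[M HM] we.
(* The input occupies register 0, so the result is built in register 1 and moved to 0 once that is
   cleared. *)
apply: (prog_recursive HM
  (p := Seq (tcomp [:: 0] 1 e) (Seq (Loop 0 (Skip _)) (Loop 1 (Inc _ 0))))) => n.
eexists.
  apply: exec_seq; first by apply: tcompP => // -[].
  apply: exec_seq; first exact: exec_clear.
  exact: exec_move.
by [].
Qed.
End Terms.

Arguments Var {I}.
Arguments Zero {I}.

(** * Arithmetic, bounded search and pairing as terms *)

Section Arithmetic.
Variables (I : finType) (f : I -> nat -> nat).
Notation tm := (tm I).
Notation denote := (denote f).

Definition tconst n : tm := iter n (@Succ I) Zero.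

Lemma denote_const n env : denote env (tconst n) = n.
Proof. by elim: n => //= n ->. Qed.

Lemma wf_const n k : wf k (tconst n).
Proof. by elim: n. Qed.

Definition tadd : tm := Rec (Var 1) (Var 0) (Succ (Var 3)).

Lemma denote_add x y : denote [:: x; y] tadd = x + y.
Proof. by rewrite /=; elim: y x => [|y IH] x /=; rewrite ?addn0 // IH addnS. Qed.

Definition tmul : tm := Rec (Var 1) Zero (App2 tadd (Var 3) (Var 0)).

Definition tsg : tm := Rec (Var 0) Zero (Succ Zero).

Lemma denote_sg n : denote [:: n] tsg = (n != 0).
Proof.
rewrite /=; case: n => //= n.
by elim: n 1 (erefl 1) => [|n IH] a //= _; apply: IH.
Qed.

Definition tnot : tm := Rec (Var 0) (Succ Zero) Zero.

Lemma denote_not n : denote [:: n] tnot = (n == 0).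
Proof. by rewrite /=; case: n => //= n; elim: n. Qed.

Local Opaque tadd.
Local Opaque tsg.
Local Opaque tnot.
Local Opaque tconst.

Lemma denote_mul x y : denote [:: x; y] tmul = x * y.
Proof.
rewrite /= -[RHS]addn0; elim: y 0 => [|y IH] a /=; rewrite ?muln0 //.
by rewrite IH denote_add mulnS; lia.
Qed.

(** Of the [n] counter values below [n], all but 0 contribute 1 to the sum. *)
Definition tpred : tm := Rec (Var 0) Zero (App2 tadd (Var 2) (App1 tsg (Var 1))).

Lemma denote_pred n : denote [:: n] tpred = n.-1.
Proof.
rewrite /= -[RHS]addn0; elim: n 0 => [|n IH] a //=.
by rewrite IH denote_sg denote_add; lia.
Qed.

Local Opaque tmul.
Local Opaque tpred.

Definition tsub : tm := Rec (Var 1) (Var 0) (App1 tpred (Var 3)).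

Lemma denote_sub x y : denote [:: x; y] tsub = x - y.
Proof.
rewrite /=; elim: y x => [|y IH] x /=; first by rewrite subn0.
by rewrite IH denote_pred; lia.
Qed.

Local Opaque tsub.

Definition tle : tm := App1 tnot (App2 tsub (Var 0) (Var 1)).

Lemma denote_le x y : denote [:: x; y] tle = (x <= y).
Proof. by rewrite /= denote_sub denote_not subn_eq0. Qed.

Local Opaque tle.

Definition teq : tm := App2 tmul (App2 tle (Var 0) (Var 1)) (App2 tle (Var 1) (Var 0)).

Lemma denote_eq x y : denote [:: x; y] teq = (x == y).
Proof. by rewrite /= denote_mul !denote_le eqn_leq mulnb. Qed.

Local Opaque teq.

Definition tif c a b : tm :=
  App2 tadd (App2 tmul (App1 tsg c) a) (App2 tmul (App1 tnot c) b).

Lemma denote_if env c a b :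
  denote env (tif c a b) = if denote env c != 0 then denote env a else denote env b.
Proof.
rewrite /= denote_add !denote_mul denote_sg denote_not.
by case: eqP => _ /=; rewrite ?mul1n ?mul0n ?addn0.
Qed.

Lemma wf_if k c a b : wf k (tif c a b) = [&& wf k c, wf k a & wf k b].
Proof. by rewrite /=; case: (wf k c); rewrite //= andbT. Qed.

Local Opaque tif.

Definition denoteE := (denote_const, denote_add, denote_mul, denote_sg, denote_not, denote_pred,
  denote_sub, denote_le, denote_eq, denote_if).

(* The loop counter runs downwards, so this is the least [k < n] with [P k]. *)
Definition search (n : nat) (P : pred nat) : nat :=
  downto n (fun k a => if P k then k else a) 0.

Lemma searchE n (P : pred nat) m :
  m < n -> P m -> (forall k, k < m -> ~~ P k) -> search n P = m.
Proof.
rewrite /search => mn Pm Hm.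
have E j b : j <= m -> downto j (fun k a => if P k then k else a) b = b.
  by elim: j b => //= j IH b jm; rewrite (negbTE (Hm j jm)) IH // ltnW.
elim: n 0 mn => // n IH a /=.
by rewrite ltnS leq_eqVlt => /predU1P[<-|/IH -> //]; rewrite Pm E.
Qed.

Lemma downto_ext n g g' a : (forall k b, g k b = g' k b) ->
  downto n g a = downto n g' a.
Proof. by move=> e; elim: n a => //= n IH a; rewrite IH e. Qed.

Lemma denote_Rec env en e0 es : denote env (Rec en e0 es) =
  downto (denote env en) (fun k a => denote (env ++ [:: k; a]) es) (denote env e0).
Proof. by []. Qed.

(** The quotient is found as the least [k <= n] with [n < k.+1 * d]. *)
Definition tdiv : tm :=
  Rec (Succ (Var 0)) Zero
    (tif (App2 tle (Succ (Var 0)) (App2 tmul (Succ (Var 2)) (Var 1))) (Var 2) (Var 3)).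

Lemma denote_div n d : 0 < d -> denote [:: n; d] tdiv = n %/ d.
Proof.
move=> d0; rewrite -[RHS](@searchE n.+1 (fun k => n < k.+1 * d)) /tdiv.
- rewrite [LHS]denote_Rec; apply: downto_ext => k a /=.
  by rewrite denoteE /= !denoteE; case: ltnP.
- by rewrite ltnS leq_div.
- exact: ltn_ceil.
- by move=> k; rewrite leq_divRL // -leqNgt.
Qed.

Definition todd : tm := Rec (Var 0) Zero (App1 tnot (Var 2)).

Lemma denote_odd n : denote [:: n] todd = odd n.
Proof.
rewrite /= (@downto_ext _ _ (fun _ b => b == 0 : nat)); last first.
  by move=> k b; rewrite denoteE.
have E b : downto n (fun _ b => b == 0 : nat) (nat_of_bool b) = b (+) odd n.
  elim: n b => [|n IH] b /=; first by rewrite addbF.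
  have -> : (nat_of_bool b == 0) = ~~ b by case: b.
  by rewrite IH; case: b; case: odd.
exact: (E false).
Qed.

Definition ttri : tm := Rec (Var 0) Zero (App2 tadd (Var 2) (Succ (Var 1))).

Local Opaque tdiv.
Local Opaque todd.

Lemma denote_tri n : denote [:: n] ttri = nat_rec _ 0 (fun i m => i.+1 + m)%coq_nat n.
Proof.
rewrite /= (@downto_ext _ _ (fun k b => b + k.+1)); last first.
  by move=> k b; rewrite denoteE.
have E a : downto n (fun k b => b + k.+1) a =
    nat_rec _ 0 (fun i m => i.+1 + m)%coq_nat n + a.
  by elim: n a => //= n IH a; rewrite IH; lia.
by rewrite E addn0.
Qed.

Local Opaque ttri.

Definition tpair : tm := App2 tadd (Var 1) (App1 ttri (App2 tadd (Var 1) (Var 0))).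

Lemma denote_pair x y : denote [:: x; y] tpair = Cantor.to_nat (x, y).
Proof. by rewrite /= !denoteE denote_tri. Qed.

Local Opaque tpair.

Lemma Cantor_ge x y : x <= Cantor.to_nat (x, y) /\ y <= Cantor.to_nat (x, y).
Proof. by have := Cantor.to_nat_non_decreasing x y; lia. Qed.

(** Both components of a pair are bounded by its code ([Cantor_ge]), so unpairing is a bounded
    search; the inner loop tests whether some second component fits the candidate. *)
Definition tfst : tm :=
  Rec (Succ (Var 0)) Zero (tif
    (Rec (Succ (Var 0)) Zero
      (tif (App2 teq (App2 tpair (Var 1) (Var 3)) (Var 0)) (Succ Zero) (Var 4)))
    (Var 1) (Var 2)).

Lemma downto_has n (P : pred nat) :
  downto n (fun k a => if P k then 1 else a) 0 = has P (iota 0 n).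
Proof.
have E b : downto n (fun k a => if P k then 1 else a) (nat_of_bool b) =
    b || has P (iota 0 n).
  elim: n b => [|n IH] b; first by rewrite orbF.
  rewrite [LHS]/= -[n.+1]addn1 iotaD has_cat /= orbF add0n.
  have -> : (if P n then 1 else b : nat) = (P n || b) by case: (P n).
  by rewrite IH; case: (P n); rewrite ?orbT //= orbF.
exact: (E false).
Qed.

Lemma denote_fst x y : denote [:: Cantor.to_nat (x, y)] tfst = x.
Proof.
set z := Cantor.to_nat (x, y).
pose Q x := has (fun y => Cantor.to_nat (x, y) == z) (iota 0 z.+1).
rewrite -[RHS](@searchE z.+1 Q).
- rewrite [LHS]denote_Rec; apply: downto_ext => k a /=; rewrite denoteE.
  suff -> : denote [:: z; k; a] (Rec (Succ (Var 0)) Zero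
      (tif (App2 teq (App2 tpair (Var 1) (Var 3)) (Var 0)) (Succ Zero) (Var 4))) = Q k.
    by case: (Q k).
  rewrite /Q -downto_has [LHS]denote_Rec; apply: downto_ext => j b; rewrite [X in X = _]/=.
  by rewrite denoteE [X in X != 0]/= denoteE denote_pair; case: (_ == z).
- by rewrite ltnS; case: (Cantor_ge x y).
- apply/hasP; exists y; last by rewrite eqxx.
  by rewrite mem_iota add0n ltnS; case: (Cantor_ge x y).
move=> k kx; apply/hasPn => j _; apply: contraTneq kx => /(congr1 Cantor.of_nat).
by rewrite /z !Cantor.cancel_of_to => -[-> _]; rewrite ltnn.
Qed.

Local Opaque tfst.

(** The map [n.-1./2] takes the code of [rcons s x] to that of [s], see [half_sit_code]. *)
Definition thalf : tm :=
  Rec (Var 0) Zero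
    (tif (App2 tle (Var 0) (Succ (Succ (App2 tadd (Var 1) (Var 1))))) (Var 1) (Var 2)).

Lemma denote_half n : denote [:: n] thalf = n.-1./2.
Proof.
case: n => // n; rewrite -[RHS](@searchE n.+1 (fun k => n.+1 <= k.*2.+2)).
- rewrite [LHS]denote_Rec; apply: downto_ext => k a /=; rewrite denoteE.
  by rewrite [X in X != 0]/= !denoteE addnn; case: leqP.
- by lia.
- by lia.
- by move=> k; lia.
Qed.

Local Opaque thalf.

Definition titer : tm := Rec (Var 0) (Var 1) (App1 thalf (Var 3)).

Lemma denote_iter k n : denote [:: k; n] titer = iter k (fun c => c.-1./2) n.
Proof.
rewrite [LHS]/= (@downto_ext _ _ (fun _ b => b.-1./2)).
  by elim: k n => // k IH n; rewrite iterSr -IH.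
by move=> j b; rewrite /= denote_half.
Qed.

Local Opaque titer.
End Arithmetic.

(** * Recursive products over prefixes *)

Lemma recursive_ext (g g' : nat -> nat) : g =1 g' -> recursive g -> recursive g'.
Proof. by move=> /funext ->. Qed.

(** The factor of a step is a function of the situation reached, whose code determines both the
    situation before the step and the outcome. *)
Definition prefix_prod (F : nat -> nat) (s : situation) : nat :=
  \prod_(i < size s) F (sit_code (take i.+1 s)).

Lemma prefix_prod_rcons F s x :
  prefix_prod F (rcons s x) = prefix_prod F s * F (sit_code (rcons s x)).
Proof.
rewrite /prefix_prod size_rcons big_ord_recr /=; congr (_ * F (sit_code _)).
  apply: eq_bigr => i _; congr (F (sit_code _)).
  by rewrite -cats1 takel_cat.
by rewrite take_oversize // size_rcons.
Qed.

Lemma size_le_sit_code s : size s <= sit_code s.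
Proof.
by elim/last_ind: s => // s x IH; rewrite size_rcons sit_code_rcons; lia.
Qed.

Lemma half_sit_code s x : (sit_code (rcons s x)).-1./2 = sit_code s.
Proof. by rewrite sit_code_rcons addnS /=; case: x; lia. Qed.

(** Iterated halving runs through the codes of the prefixes, longest first, and then stays at 0, the
    code of the empty situation, where the factor is 1. Any number of rounds from [size s] on thus
    gives the same product, and the code itself can serve as that number. *)
Lemma prefix_prodE F s n : size s <= n ->
  \prod_(k < n) (let c := iter k (fun c => c.-1./2) (sit_code s) in
                 if c != 0 then F c else 1) = prefix_prod F s.
Proof.
elim/last_ind: s n => [|s x IH] n.
  move=> _; rewrite /prefix_prod big_ord0 big1 // => k _.
  by have -> : iter k (fun c => c.-1./2) (sit_code [::]) = 0 by elim: (k : nat) => //= j ->.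
rewrite size_rcons; case: n => // n sn; rewrite big_ord_recl prefix_prod_rcons mulnC.
congr (_ * _).
  rewrite -(IH n sn); apply: eq_bigr => k _.
  by rewrite [X in iter X]/= /bump add1n iterSr half_sit_code.
by rewrite /= sit_code_rcons addnS.
Qed.

Lemma downto_prod n (g : nat -> nat) a :
  downto n (fun k b => b * g k) a = a * \prod_(k < n) g k.
Proof.
elim: n a => [|n IH] a /=; first by rewrite big_ord0 muln1.
by rewrite IH big_ord_recr /= -mulnA [g n * _]mulnC.
Qed.

Section PrefixProd.
Variable F : nat -> nat.

Definition tprefix_prod : tm unit :=
  let c := App2 (titer _) (Var 1) (Var 0) in
  Rec (Var 0) (Succ Zero)
    (tif c (App2 (tmul _) (Var 2) (Orc tt c)) (Var 2)).

Notation f := (fun _ : unit => F).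

Lemma wf_fst (I : finType) : wf 1 (tfst I).
Proof. by []. Qed.

Local Opaque tfst titer tmul tif.

Lemma denote_prefix_prod s : denote f [:: sit_code s] tprefix_prod = prefix_prod F s.
Proof.
pose g k := let c := iter k (fun c => c.-1./2) (sit_code s) in if c != 0 then F c else 1.
rewrite /tprefix_prod denote_Rec (@downto_ext _ _ (fun k b => b * g k)); last first.
  move=> k b; rewrite [LHS]/= denoteE /= !denote_iter !denoteE /g.
  by case: ifP; rewrite ?muln1.
by rewrite downto_prod mul1n; apply/prefix_prodE/size_le_sit_code.
Qed.

Lemma prefix_prod_recursive :
  recursive F -> recursive_sit_nat (fun s _ => prefix_prod F s).
Proof.
move=> HF; exists (fun z => denote f [:: z] (App1 tprefix_prod (App1 (tfst _) (Var 0)))).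
  by apply: term_recursive; rewrite //= wf_fst.
move=> s n; rewrite -denote_prefix_prod -[in RHS](denote_fst f (sit_code s) n).
by [].
Qed.
End PrefixProd.

(** * Rounding computable processes *)

Section Floor.
Variables (sg num den e : nat -> nat) (N : nat).
Hypothesis den_gt0 : forall p n, 0 < den (Cantor.to_nat (p, n)).

Definition floor_oracle (o : 'I_4) : nat -> nat :=
  match val o with 0 => sg | 1 => num | 2 => den | _ => e end.

(* Codes of negative rationals are sent to 0. *)
Definition floor_fun (p : nat) : nat :=
  let z := Cantor.to_nat (p, e (Cantor.to_nat (p, N))) in
  if odd (sg z) then 0 else num z * 2 ^ N %/ den z.

Definition tfloor : tm 'I_4 :=
  let z := App2 (tpair _) (Var 0)
    (Orc (@Ordinal 4 3 isT) (App2 (tpair _) (Var 0) (tconst _ N))) in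
  tif (App1 (todd _) (Orc (@Ordinal 4 0 isT) z)) Zero
    (App2 (tdiv _) (App2 (tmul _) (Orc (@Ordinal 4 1 isT) z) (tconst _ (2 ^ N)))
       (Orc (@Ordinal 4 2 isT) z)).

Local Opaque tconst tif.

Lemma wf_floor : wf 1 tfloor.
Proof. by rewrite /tfloor wf_if /= !wf_const. Qed.

Local Opaque tpair todd tdiv tmul.

Lemma denote_floor p : denote floor_oracle [:: p] tfloor = floor_fun p.
Proof.
rewrite /tfloor denoteE /= !denote_pair !denote_odd !denoteE /floor_fun.
by rewrite denote_div //; case: odd.
Qed.

Lemma floor_fun_recursive : recursive sg -> recursive num -> recursive den ->
  recursive e -> recursive floor_fun.
Proof.
move=> h0 h1 h2 h3; apply: recursive_ext denote_floor _.
by apply: term_recursive wf_floor => -[[|[|[|]]]].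
Qed.
End Floor.

(** * Integer numerators of the factors of the test processes *)

Section Factor.
Variables (S Q : nat -> nat) (B D : nat).

(* The code [c] of a situation [s] followed by [x] determines the code [p] of [s],
   and [c - (2 p + 1)] is [x]. With [B = 2 ^ m * D] and [D = 2 ^ m], the quotient
   by [B] is [1 - 2 ^- m * S s * (x - (Q - 1) / D)]. *)
Definition lower_factor (c : nat) : nat :=
  let p := c.-1./2 in B + S p * (Q p - 1) - S p * ((c - p.*2.+1) * D).

(** With the same [B] and [D], the quotient by [B] is [1 - 2 ^- m * S s * ((Q + 2) / D - x)]. Adding
    before subtracting avoids truncation. *)
Definition upper_factor (c : nat) : nat :=
  let p := c.-1./2 in B + S p * ((c - p.*2.+1) * D) - S p * (Q p + 2).

Definition factor_oracle (o : bool) : nat -> nat := if o then S else Q.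

Definition tdigit : tm bool :=
  let p := App1 (thalf _) (Var 0) in
  App2 (tmul _) (App2 (tsub _) (Var 0) (Succ (App2 (tadd _) p p))) (tconst _ D).

Definition tlower_factor : tm bool :=
  let p := App1 (thalf _) (Var 0) in
  App2 (tsub _)
    (App2 (tadd _) (tconst _ B)
       (App2 (tmul _) (Orc true p) (App1 (tpred _) (Orc false p))))
    (App2 (tmul _) (Orc true p) tdigit).

Definition tupper_factor : tm bool :=
  let p := App1 (thalf _) (Var 0) in
  App2 (tsub _)
    (App2 (tadd _) (tconst _ B) (App2 (tmul _) (Orc true p) tdigit))
    (App2 (tmul _) (Orc true p) (Succ (Succ (Orc false p)))).

Local Opaque tconst.

Lemma wf_lower_factor : wf 1 tlower_factor.
Proof. by rewrite /= !wf_const. Qed.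

Lemma wf_upper_factor : wf 1 tupper_factor.
Proof. by rewrite /= !wf_const. Qed.

Local Opaque thalf tmul tsub tadd tpred.

Lemma lower_factor_recursive :
  recursive S -> recursive Q -> recursive lower_factor.
Proof.
move=> hS hQ; apply: recursive_ext (term_recursive (f := factor_oracle) _ wf_lower_factor).
  by move=> c; rewrite /= !denote_half !denoteE /lower_factor addnn subn1.
by case.
Qed.

Lemma upper_factor_recursive :
  recursive S -> recursive Q -> recursive upper_factor.
Proof.
move=> hS hQ; apply: recursive_ext (term_recursive (f := factor_oracle) _ wf_upper_factor).
  by move=> c; rewrite /= !denote_half !denoteE /upper_factor addnn addn2.
by case.
Qed.
End Factor.

Lemma const_recursive n : recursive (fun=> n).
Proof.
have := term_recursive (f := fun o : void => of_void _ o) _ (wf_const _ n 1).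
by move=> H; apply: recursive_ext (H _) => [k|[]]; rewrite denote_const.
Qed.

(** * Test supermartingales *)

Local Open Scope classical_set_scope.
Local Open Scope ring_scope.

Lemma prefix_prod_const D s : prefix_prod (fun=> D) s = (D ^ size s)%N.
Proof. by rewrite /prefix_prod prod_nat_const card_ord. Qed.

Section Analysis.
Variable R : realType.

Definition product_process (F : nat -> nat) (D : nat) : real_process R :=
  fun s => (prefix_prod F s)%:R / D%:R ^+ size s.

Lemma product_process_rcons F D s x : product_process F D (rcons s x) =
  product_process F D s * ((F (sit_code (rcons s x)))%:R / D%:R).
Proof.
by rewrite /product_process prefix_prod_rcons natrM size_rcons exprSr invfM; ring.
Qed.

Lemma product_process_nil F D : product_process F D [::] = 1.
Proof. by rewrite /product_process /prefix_prod big_ord0 expr0 divr1. Qed.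

(** The values are rationals given exactly, so the modulus is 0; the denominators form the prefix
    product of the constant [D]. *)
Lemma product_process_computable F D : (0 < D)%N -> recursive F ->
  computable (product_process F D).
Proof.
move=> D0 HF.
exists (fun s _ => (prefix_prod F s)%:R / (D ^ size s)%:R), (fun _ _ => 0%N); split.
- exists (fun _ _ => 0%N), (fun s _ => prefix_prod F s), (fun s _ => (D ^ size s)%N).
  split=> [||| s n|s n].
  + by exists (fun=> 0%N) => //; apply: const_recursive.
  + exact: prefix_prod_recursive.
  + have [g hg eg] := prefix_prod_recursive (const_recursive D).
    by exists g => // s n; rewrite eg prefix_prod_const.
  + by rewrite -lt0n expn_gt0 D0.
  + by rewrite expr0 mul1r.
- by exists (fun=> 0%N) => //; apply: const_recursive.
move=> s N n _; rewrite fmorph_div /= !ratr_nat natrX subrr normr0.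
by rewrite invr_ge0 exprn_ge0.
Qed.

Lemma upper_expectation_le0 (J : subinterval R) (g : gamble R) :
  (forall p, lo J <= p <= hi J -> Defs.expectation p g <= 0) ->
  upper_expectation J g <= 0.
Proof.
move=> H; apply: ge_sup; last by move=> _ [p /H ? <-].
by exists (Defs.expectation (lo J) g), (lo J) => //; rewrite /in_subinterval /= lexx lo_le_hi.
Qed.

Lemma lower_expectation_le (J : subinterval R) (g : gamble R) p :
  lo J <= p <= hi J -> lower_expectation J g <= Defs.expectation p g.
Proof.
move=> hp; apply: ge_inf; last by exists p.
(* [ge_inf] asks for a lower bound of the set; this one works because [q] lies in the unit
   interval. *)
exists (- (`|g true| + `|g false|)) => _ [q /andP[q1 q2] <-].
have q0 := le_trans (lo_ge0 J) q1; have q1' := le_trans q2 (hi_le1 J).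
have bound (c v : R) : 0 <= c -> c <= 1 -> - `|v| <= c * v.
  move=> c0 c1; rewrite lerNl; apply: le_trans (ler_norm _) _.
  by rewrite normrN normrM (ger0_norm c0) ler_piMl.
have := bound _ (g true) q0 q1'.
have : - `|g false| <= (1 - q) * g false by apply: bound; lra.
by rewrite /Defs.expectation; lra.
Qed.

(** Positivity and computability put the process into every allowable [A], and the bound on the
    expected factors makes it a supermartingale, so randomness applies. *)
Lemma random_product_bounded (A : set (real_process R)) (phi : forecasting_system R)
    omega F D :
  allowable A -> random_for A phi omega -> (0 < D)%N -> recursive F ->
  (forall s x, (0 < F (sit_code (rcons s x)))%N) ->
  (forall s p, lo (phi s) <= p <= hi (phi s) ->
     p * (F (sit_code (rcons s true)))%:R +
     (1 - p) * (F (sit_code (rcons s false)))%:R <= D%:R) ->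
  exists C, forall n, product_process F D (initseg omega n) <= C.
Proof.
move=> [_ _ HA] Hr D0 HF F0 Hs; pose T := product_process F D.
have D0' : 0 < D%:R :> R by rewrite ltr0n.
have T0 : positive_process T.
  elim/last_ind => [|s x IH]; first by rewrite /T product_process_nil.
  by rewrite /T product_process_rcons mulr_gt0 // divr_gt0 // ltr0n.
have Tt : test_process T by split; [move=> s; apply/ltW|apply: product_process_nil].
have AT : A T by apply: HA => //; apply: product_process_computable.
have Ts : test_supermartingale phi T.
  split=> // s; apply: upper_expectation_le0 => p hp.
  rewrite /Defs.expectation /process_diff /T !product_process_rcons -/(T s).
  set u := (F _)%:R; set v := (F _)%:R.
  have -> : p * (T s * (u / D%:R) - T s) + (1 - p) * (T s * (v / D%:R) - T s)
     = T s * ((p * u + (1 - p) * v) / D%:R - 1).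
    by field; rewrite gt_eqF.
  by rewrite pmulr_rle0 // subr_le0 ler_pdivrMr // mul1r; apply: Hs.
have [b hb] : exists b : R, (ereal_sup
    [set (T (initseg omega n))%:E | n in [set n | (1 <= n)%N]] <= b%:E)%E.
  have := Hr T AT Ts; case: ereal_sup => [r _|//|_]; first by exists r.
  by exists 0; rewrite leNye.
(* The supremum in [random_for] starts at index 1; the maximum with 1 covers the empty situation. *)
exists (Num.max 1 b) => -[|n]; first by rewrite product_process_nil le_max lexx.
rewrite le_max; apply/orP; right; rewrite -lee_fin; apply: le_trans hb.
by apply: ereal_sup_ubound; exists n.+1.
Qed.

(** By [expR u >= 1 + u] with [u = z + 2 * z ^+ 2], it is enough that [(1 - z) * (1 + u) = 1 + z ^+
    2 * (1 - 2 * z)] is at least 1. *)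
Lemma expR_le_1B (z : R) : `|z| <= 2^-1 -> expR (- (z + 2 * z ^+ 2)) <= 1 - z.
Proof.
rewrite ler_norml => /andP[z1 z2].
rewrite expRN -[_^-1]div1r ler_pdivrMr ?expR_gt0 //.
have h : 1 + (z + 2 * z ^+ 2) <= expR (z + 2 * z ^+ 2) by apply: expR_ge1Dx.
have h1 : 0 <= 1 - z by lra.
apply: le_trans (ler_wpM2l h1 h).
have : 0 <= z ^+ 2 * (1 - 2 * z) by rewrite mulr_ge0 ?sqr_ge0 //; lra.
by rewrite !expr2; lra.
Qed.

(** The inequality [expR u >= 1 + u] is applied once more, to the whole sum, in place of a
    logarithm; hence the term [C / xi]. The 8 is twice the bound 4 on the squares of [y]. *)
Lemma product_lower_bound (n : nat) (b : nat -> bool) (y : nat -> R) (xi C : R) :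
  0 < xi -> xi <= 4^-1 -> (forall k, `|y k| <= 2) ->
  \prod_(0 <= k < n) (1 - xi * ((b k)%:R * y k)) <= C ->
  - (8 * xi) * \sum_(0 <= k < n) (b k)%:R - C / xi
    <= \sum_(0 <= k < n) (b k)%:R * y k.
Proof.
move=> xi0 xi1 hy hC.
pose z k := xi * ((b k)%:R * y k).
have hz k : `|z k| <= 2^-1.
  rewrite /z; case: (b k); rewrite ?mul1r ?mul0r ?mulr0 ?normr0 ?invr_ge0 //.
  rewrite normrM gtr0_norm //.
  by have := hy k; have := ler_wpM2l (ltW xi0) (hy k); lra.
have hz2 k : z k ^+ 2 <= 4 * xi ^+ 2 * (b k)%:R.
  rewrite /z; case: (b k); rewrite ?mul1r ?mul0r ?mulr0 ?expr0n ?mulr1 //.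
  rewrite exprMn mulrC ler_pM2r ?exprn_gt0 //.
  have -> : 4 = 2 ^+ 2 :> R by rewrite -natrX.
  by rewrite -real_normK ?num_real // lerXn2r // nnegrE.
have le_exp : expR (- \sum_(0 <= k < n) (z k + 2 * z k ^+ 2)) <= C.
  apply: le_trans hC; rewrite -sumrN expR_sum.
  apply: ler_prod => k _; rewrite expR_ge0 /=.
  exact: expR_le_1B (hz k).
have := le_trans (expR_ge1Dx _) le_exp.
rewrite big_split /= -mulr_sumr -mulr_sumr => h.
have h2 : \sum_(0 <= k < n) z k ^+ 2 <= 4 * xi ^+ 2 * \sum_(0 <= k < n) (b k)%:R.
  by rewrite mulr_sumr; apply: ler_sum => k _.
rewrite -(ler_pM2l xi0) mulrBr.
have -> : xi * (C / xi) = C by rewrite mulrC divfK ?gt_eqF.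
by move: h h2; rewrite expr2; lra.
Qed.
(** After scaling by [2 ^+ m], an approximation with precision [2 ^- m] is off by at most 1, and
    taking the floor loses less than 1 more. *)
Lemma computable_floor (G : real_process R) m : computable G ->
  (forall s, 0 <= G s) ->
  exists2 Q, recursive Q & forall s,
    (Q (sit_code s))%:R <= G s * 2 ^+ m + 1 /\
    G s * 2 ^+ m <= (Q (sit_code s))%:R + 2.
Proof.
move=> [r [e [[sg [num [den [[gs hs es] [gn hn en] [gd hd ed] d0 re]]]] [ge he ee] hr]]] G0.
(* Every number is the code of a situation, so the denominators are positive at all codes. *)
have gd0 p n : (0 < gd (Cantor.to_nat (p, n)))%N.
  case: sit_code_bij => c _ cK; rewrite -(cK p) ed lt0n; exact: d0.
exists (floor_fun gs gn gd ge m); first exact: floor_fun_recursive.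
move=> s; rewrite /floor_fun ee es en ed; move: (e s m) (hr s m _ (leqnn _)) => n.
move: (d0 s n) (re s n) => {}d0 ->.
rewrite fmorph_div rmorphM rmorphXn rmorphN1 /= !ratr_nat -signr_odd.
set M := 2 ^+ m; have M0 : 0 < M :> R by rewrite exprn_gt0.
have dR : 0 < (den s n)%:R :> R by rewrite ltr0n lt0n.
rewrite ler_distl => /andP[h1 h2]; have := G0 s.
have {}h1 := ler_wpM2r (ltW M0) h1; have {}h2 := ler_wpM2r (ltW M0) h2.
move: h1 h2; rewrite mulrBl mulrDl mulVf ?gt_eqF // => h1 h2 Gs0.
have GM : 0 <= G s * M by rewrite mulr_ge0 // ltW.
case: odd h1 h2; rewrite ?expr1 ?expr0 ?mul1r ?mulN1r => h1 h2.
  (* A rational with negative sign is at most 0, which forces [G s * M <= 1]; the value 0 is then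
     accurate enough. *)
  have : 0 <= (num s n)%:R / (den s n)%:R * M by rewrite mulr_ge0 ?divr_ge0 // ltW.
  by move: h1 h2; rewrite !mulNr; lra.
set q := (_ %/ _)%N.
have q1 : q%:R <= (num s n)%:R / (den s n)%:R * M.
  rewrite mulrAC ler_pdivlMr // /M -natrX -!natrM ler_nat; exact: leq_divM.
have q2 : (num s n)%:R / (den s n)%:R * M < q%:R + 1.
  rewrite mulrAC ltr_pdivrMr // /M -natrX natr1 -!natrM ltr_nat.
  by apply: ltn_ceil; rewrite lt0n.
by split; lra.
Qed.

(** This is the common part of the lower and upper cases: [y] is the deviation of the outcome from a
    rounded forecast, and its nonnegative expectation keeps the expected factor at most 1. *)
Lemma sum_initseg_bound (A : set (real_process R)) (phi : forecasting_system R)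
    omega (S : selection_process) (y : situation -> bool -> R) F m :
  allowable A -> random_for A phi omega -> (2 <= m)%N -> recursive F ->
  (forall s x, (F (sit_code (rcons s x)))%:R =
     2 ^+ (m + m) * (1 - 2 ^- m * ((S s)%:R * y s x)) :> R) ->
  (forall s x, `|y s x| <= 2) ->
  (forall s p, lo (phi s) <= p <= hi (phi s) ->
     0 <= p * y s true + (1 - p) * y s false) ->
  exists C, forall n,
    - (8 * 2 ^- m) * \sum_(0 <= k < n) (S (initseg omega k))%:R - C <=
    \sum_(0 <= k < n) (S (initseg omega k))%:R * y (initseg omega k) (omega k).
Proof.
move=> HA Hr m2 HF eF hy hs; set xi := 2 ^- m.
have xi0 : 0 < xi :> R by rewrite invr_gt0 exprn_gt0.
have xi1 : xi <= 4^-1.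
  rewrite lef_pV2 ?posrE ?exprn_gt0 //.
  have -> : 4 = 2 ^+ 2 :> R by rewrite -natrX.
  by rewrite ler_weXn2l // ler1n.
pose D := (2 ^ (m + m))%N.
have DE : D%:R = 2 ^+ (m + m) :> R by rewrite natrX.
have D0 : 0 < 2 ^+ (m + m) :> R by rewrite exprn_gt0.
have [|s x|s p hp|C hC] := @random_product_bounded A phi omega F D HA Hr _ HF.
- by rewrite expn_gt0.
- rewrite -(ltr0n R) eF mulr_gt0 // -/xi.
  have := hy s x; rewrite ler_norml => /andP[y1 y2].
  have := ler_wpM2l (ltW xi0) y2; case: (S s); rewrite ?mul1r ?mul0r ?mulr0; lra.
- rewrite !eF DE -/xi; have := hs s p hp; set u := y s true; set v := y s false => uv.
  have := mulr_ge0 (mulr_ge0 (ltW D0) (mulr_ge0 (ltW xi0) (ler0n R (S s)))) uv.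
  lra.
exists (C / xi) => n.
apply: (@product_lower_bound n (fun k => S (initseg omega k))
  (fun k => y (initseg omega k) (omega k))) => //.
apply: le_trans (hC n); rewrite le_eqVlt; apply/orP; left; apply/eqP.
elim: n => [|n IH]; first by rewrite big_nil product_process_nil.
rewrite big_nat_recr //= IH /initseg mkseqS product_process_rcons eF -DE.
by rewrite [D%:R * _]mulrC mulfK // DE gt_eqF.
Qed.

(** The 11 is 8 from [sum_initseg_bound] plus 3 for replacing [lo] by [(Q - 1) / 2 ^ m], which is at
    most [lo] and less by at most [3 * 2 ^- m]. *)
Lemma lower_sum_bound (A : set (real_process R)) (phi : forecasting_system R)
    omega (S : selection_process) m :
  allowable A -> random_for A phi omega -> recursive_selection S ->
  computable (fun s => lo (phi s)) -> (2 <= m)%N ->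
  exists C, forall n,
    - (11 * 2 ^- m) * \sum_(0 <= k < n) (S (initseg omega k))%:R - C <=
    \sum_(0 <= k < n) (S (initseg omega k))%:R *
      ((omega k)%:R - lo (phi (initseg omega k))).
Proof.
move=> HA Hr [gS hS eS] Hc m2.
have [|Q hQ eQ] := @computable_floor _ m Hc; first by move=> s; apply: lo_ge0.
have M0 : 0 < 2 ^+ m :> R by rewrite exprn_gt0.
pose y s (x : bool) : R := x%:R - (Q (sit_code s) - 1)%:R * 2 ^- m.
have Qlo s : (Q (sit_code s) - 1)%:R <= lo (phi s) * 2 ^+ m.
  have [q1 _] := eQ s; have := lo_ge0 (phi s).
  case: (Q _) q1 => [|q] q1 l0; first by rewrite mulr_ge0 // (ltW M0).
  by move: q1; rewrite subn1 /= -natr1; lra.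
have Qhi s : lo (phi s) * 2 ^+ m <= (Q (sit_code s) - 1)%:R + 3.
  have [_ q2] := eQ s; apply: le_trans q2 _.
  by case: (Q _) => [|q]; rewrite ?subn1 /= -?natr1; lra.
have Q1 s : (Q (sit_code s) - 1 <= 2 ^ m)%N.
  rewrite -(ler_nat R) natrX; apply: le_trans (Qlo s) _.
  by apply: ler_piMl (ltW M0) _; apply: le_trans (lo_le_hi _) (hi_le1 _).
have [|s x|s p /andP[p1 p2]|C hC] := @sum_initseg_bound A phi omega S y
    (lower_factor gS Q (2 ^ (m + m)) (2 ^ m)) m HA Hr m2 (lower_factor_recursive _ _ hS hQ).
- move=> s x; rewrite /lower_factor half_sit_code eS.
  have -> : (sit_code (rcons s x) - (sit_code s).*2.+1)%N = x.
    by rewrite sit_code_rcons; case: x; lia.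
  (* The truncated subtraction is exact because [2 ^ m <= 2 ^ (m + m)]. *)
  rewrite natrB; last first.
    by case: (S s); case: x; rewrite ?mul1n ?mul0n // expnD;
      have : (0 < 2 ^ m)%N; rewrite ?expn_gt0 //; nia.
  rewrite natrD !natrM !natrX exprD /y; field.
  by rewrite gt_eqF.
- have : (0 : R) <= (Q (sit_code s) - 1)%:R * 2 ^- m <= (1 : R).
    rewrite divr_ge0 ?ler0n ?(ltW M0) //= ler_pdivrMr // mul1r.
    by rewrite -natrX ler_nat.
  by rewrite /y ler_norml; case: x => /=; lra.
- have : (Q (sit_code s) - 1)%:R * 2 ^- m <= lo (phi s) by rewrite ler_pdivrMr.
  by rewrite /y /=; lra.
exists C => n.
have : \sum_(0 <= k < n) (S (initseg omega k))%:R *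
    (y (initseg omega k) (omega k) - 3 * 2 ^- m) <=
  \sum_(0 <= k < n) (S (initseg omega k))%:R *
      ((omega k)%:R - lo (phi (initseg omega k))) :> R.
  apply: ler_sum => k _; rewrite ler_wpM2l ?ler0n //.
  have : lo (phi (initseg omega k)) <= ((Q (sit_code (initseg omega k)) - 1)%:R + 3) * 2 ^- m.
    by rewrite ler_pdivlMr.
  by rewrite /y; lra.
under eq_bigr do rewrite mulrBr.
rewrite sumrB -mulr_suml; have := hC n; lra.
Qed.

(** Here [hi] is rounded up to [(Q + 2) / 2 ^ m], again at a cost of at most [3 * 2 ^- m]. The
    rounded value can exceed 1 but not 2, whence the bound 2 on [y]. *)
Lemma upper_sum_bound (A : set (real_process R)) (phi : forecasting_system R)
    omega (S : selection_process) m :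
  allowable A -> random_for A phi omega -> recursive_selection S ->
  computable (fun s => hi (phi s)) -> (2 <= m)%N ->
  exists C, forall n,
    - (11 * 2 ^- m) * \sum_(0 <= k < n) (S (initseg omega k))%:R - C <=
    \sum_(0 <= k < n) (S (initseg omega k))%:R *
      (hi (phi (initseg omega k)) - (omega k)%:R).
Proof.
move=> HA Hr [gS hS eS] Hc m2.
have [|Q hQ eQ] := @computable_floor _ m Hc.
  by move=> s; apply: le_trans (lo_ge0 _) (lo_le_hi _).
have M0 : 0 < 2 ^+ m :> R by rewrite exprn_gt0.
have M4 : 4 <= 2 ^+ m :> R.
  have -> : 4 = 2 ^+ 2 :> R by rewrite -natrX.
  by rewrite ler_weXn2l // ler1n.
pose y s (x : bool) : R := (Q (sit_code s) + 2)%:R * 2 ^- m - x%:R.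
have Qlo s : (Q (sit_code s) + 2)%:R <= hi (phi s) * 2 ^+ m + 3.
  by have [q1 _] := eQ s; rewrite natrD; lra.
have Qhi s : hi (phi s) * 2 ^+ m <= (Q (sit_code s) + 2)%:R.
  by have [_ q2] := eQ s; rewrite natrD.
have Q1 s : (Q (sit_code s) + 2 <= 2 ^ m + 3)%N.
  rewrite -(ler_nat R) (natrD _ (2 ^ m)%N) natrX; apply: le_trans (Qlo s) _.
  by rewrite lerD2r; apply: ler_piMl (ltW M0) _; apply: hi_le1.
have [|s x|s p /andP[p1 p2]|C hC] := @sum_initseg_bound A phi omega S y
    (upper_factor gS Q (2 ^ (m + m)) (2 ^ m)) m HA Hr m2 (upper_factor_recursive _ _ hS hQ).
- move=> s x; rewrite /upper_factor half_sit_code eS.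
  have -> : (sit_code (rcons s x) - (sit_code s).*2.+1)%N = x.
    by rewrite sit_code_rcons; case: x; lia.
  (* The subtraction is exact because [2 ^ m + 3 <= 2 ^ (m + m)] once [4 <= 2 ^ m]. *)
  rewrite natrB; last first.
    have := Q1 s; have : (4 <= 2 ^ m)%N by rewrite -(ler_nat R) natrX.
    by rewrite expnD; case: (S s); case: x; rewrite ?mul1n ?mul0n //; nia.
  rewrite natrD !natrM !natrX exprD /y; field.
  by rewrite gt_eqF.
- have : (0 : R) <= (Q (sit_code s) + 2)%:R * 2 ^- m <= (2 : R).
    rewrite divr_ge0 ?ler0n ?(ltW M0) //= ler_pdivrMr //.
    have : (Q (sit_code s) + 2)%:R <= 2 ^+ m + 3 :> R.
      by have := Q1 s; rewrite -(ler_nat R) (natrD _ (2 ^ m)%N) natrX.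
    lra.
  by rewrite /y ler_norml; case: x => /=; lra.
- have : hi (phi s) <= (Q (sit_code s) + 2)%:R * 2 ^- m by rewrite ler_pdivlMr.
  by rewrite /y /=; lra.
exists C => n.
have : \sum_(0 <= k < n) (S (initseg omega k))%:R *
    (y (initseg omega k) (omega k) - 3 * 2 ^- m) <=
  \sum_(0 <= k < n) (S (initseg omega k))%:R *
      (hi (phi (initseg omega k)) - (omega k)%:R) :> R.
  apply: ler_sum => k _; rewrite ler_wpM2l ?ler0n //.
  have : (Q (sit_code (initseg omega k)) + 2)%:R * 2 ^- m <=
      hi (phi (initseg omega k)) + 3 * 2 ^- m.
    by rewrite ler_pdivrMr // mulrDl mulfVK // gt_eqF.
  by rewrite /y; lra.
under eq_bigr do rewrite mulrBr.
rewrite sumrB -mulr_suml; have := hC n; lra.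
Qed.

Lemma limn_einf_ge0 (u : nat -> R) :
  (forall e, 0 < e -> \forall n \near \oo, - e <= u n) ->
  (0 <= limn_einf (fun n => (u n)%:E))%E.
Proof.
move=> H; apply/lee_addgt0Pr => e e0; rewrite -leeBlDr // sub0e limn_einf_lim.
apply: lime_ge; first exact: is_cvg_einfs.
have [N _ HN] := H e e0; exists N => // n /= Nn.
apply: le_ereal_inf_tmp => _ [k /= nk <-]; rewrite lee_fin.
by apply: HN => /=; apply: leq_trans nk.
Qed.
End Analysis.

(** As [h] is affine in the outcome with slope [h true - h false], its expectation is least at [lo]
    for a nonnegative slope and at [hi] for a negative one; the deviation of [h] is then at least
    the absolute slope times that of the outcome. *)
Lemma gamble_sum_bound (R : realType) (A : set (real_process R))
    (phi : forecasting_system R) omega (S : selection_process) (h : gamble R) m :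
  allowable A -> random_for A phi omega -> recursive_selection S ->
  computable_forecasting phi -> (2 <= m)%N ->
  exists C, forall n,
    `|h true - h false| * (- (11 * 2 ^- m) *
       \sum_(0 <= k < n) (S (initseg omega k))%:R - C) <=
    \sum_(0 <= k < n) (S (initseg omega k))%:R *
      (h (omega k) - lower_expectation (phi (initseg omega k)) h).
Proof.
move=> HA Hr HS [Hlo Hhi] m2; set c := h true - h false.
have hE x : h x = h false + c * x%:R by rewrite /c; case: x => /=; ring.
have EE J p : lo J <= p <= hi J -> lower_expectation J h <= h false + c * p.
  by move=> /lower_expectation_le /le_trans; apply; rewrite /Defs.expectation /c; lra.
have [c0|c0] := leP 0 c.
  have [C HC] := lower_sum_bound HA Hr HS Hlo m2; exists C => n.
  rewrite ger0_norm //; apply: le_trans (ler_wpM2l c0 (HC n)) _.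
  rewrite mulr_sumr; apply: ler_sum => k _; rewrite mulrCA ler_wpM2l ?ler0n //.
  rewrite hE; have := EE (phi (initseg omega k)) (lo (phi (initseg omega k))).
  by rewrite lexx lo_le_hi => /(_ isT); lra.
have [C HC] := upper_sum_bound HA Hr HS Hhi m2; exists C => n.
have c1 : 0 <= - c by lra.
rewrite ltr0_norm //; apply: le_trans (ler_wpM2l c1 (HC n)) _.
rewrite mulr_sumr; apply: ler_sum => k _; rewrite mulrCA ler_wpM2l ?ler0n //.
rewrite hE; have := EE (phi (initseg omega k)) (hi (phi (initseg omega k))).
by rewrite lexx lo_le_hi => /(_ isT); lra.
Qed.

(* [omega k] is the entry of index [k.+1] of the path [omega]. *)
Theorem theorem23 (R : realType) (A : set (real_process R))
  (A_allowable : allowable A)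
  (phi : forecasting_system R) (phi_computable : computable_forecasting phi)
  (omega : binpath) (omega_random : random_for A phi omega)
  (S : selection_process) (S_recursive : recursive_selection S)
  (S_infinite : (fun n : nat => \sum_(0 <= k < n.+1)
                   (S (initseg omega k))%:R : R) @ \oo --> +oo)
  (h : gamble R) :
  (0 <= limn_einf (fun n : nat =>
     ((\sum_(0 <= k < n) (S (initseg omega k))%:R *
         (h (omega k) -
            lower_expectation (interval_forecast phi omega k.+1) h)) /
      (\sum_(0 <= k < n) (S (initseg omega k))%:R))%:E))%E.
Proof.
apply: limn_einf_ge0 => e e0; set c := `|h true - h false|.
have c0 : 0 <= c := normr_ge0 _.
(* Of the 12, 11 come from [gamble_sum_bound] and 1 is reserved for its constant [C]. The offset 2
   gives [2 <= m]. *)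
pose m := (Num.truncn (12 * c / e)).+2.
have me : c * (12 * 2 ^- m) <= e.
  have m1 : 12 * c / e <= 2 ^+ m.
    apply: le_trans (ltW (truncnS_gt _)) _; rewrite -natrX ler_nat.
    by apply: leq_trans (ltnW (ltn_expl m (isT : 1 < 2)%N)).
  rewrite mulrA ler_pdivrMr ?exprn_gt0 // mulrC.
  by move: m1; rewrite ler_pdivrMr // mulrC [_ * e]mulrC.
have [C HC] := gamble_sum_bound h A_allowable omega_random S_recursive phi_computable
  (isT : (2 <= m)%N).
(* At least one selection makes the denominator positive, and [C * 2 ^+ m] selections bring [C]
   below [2 ^- m] times their number. *)
have /cvgryPge /(_ (Num.max 1 (C * 2 ^+ m))) [N _ HN] := S_infinite.
(* The hypothesis has [n.+1] terms at index [n], the averages have [n]; hence the shift by one. *)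
exists N.+1 => // -[|n] //= Nn.
have {HN} := HN n Nn; rewrite /= ge_max => /andP[].
have := HC n.+1; set s := \sum_(0 <= k < n.+1) _%:R => HCn s1 sC.
rewrite ler_pdivlMr; last by apply: lt_le_trans s1.
apply: le_trans HCn; rewrite -/c.
have xi0 : 0 < 2 ^- m :> R by rewrite invr_gt0 exprn_gt0.
have {}sC : C <= s * 2 ^- m by rewrite ler_pdivlMr ?exprn_gt0.
have h1 : c * C <= c * (s * 2 ^- m) by apply: ler_wpM2l.
have h2 : c * (12 * 2 ^- m) * s <= e * s by apply: ler_wpM2r => //; lra.
lra.
Qed.
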